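(* There exists a numerical constant $C>0$ such that the following holds. Let $d,m,n$ be positive integers and $\delta\in(0,1)$, and assume $$m\wedge n\ge d\log d+\log(1/\delta).$$ Then for every $\pi^\star\in S_d$ and every positive definite $\Sigma\in\mathbb{R}^{d\times d}$ with $\|\Sigma\|_{\mathrm{op}}\le1$, with probability at least $1-\delta$, $$\big\|\Sigma^{\widehat\pi^{\mathsf{GW}}}-\Sigma^{\pi^\star}\big\|_{\mathrm F}^2\le C\left(\frac{d\log d+\log(1/\delta)}{m\wedge n}+\sqrt{\frac{d\,(d\log d+\log(1/\delta))(d+\log(1/\delta))}{mn}}\right).$$
   Context: $S_d$ is the set of permutations of $\{1,\dots,d\}$. For $A\in\mathbb{R}^{d\times d}$ and $\pi\in S_d$, $(A^\pi)_{i,j}=A_{\pi(i),\pi(j)}$. $\langle A,B\rangle=\mathrm{Tr}(AB^\top)$; $\|\cdot\|_{\mathrm F}$ and $\|\cdot\|_{\mathrm{op}}$ are the Frobenius and operator norms; $a\wedge b=\min(a,b)$. Covariance alignment model: $\Sigma\succ0$ is an unknown $d\times d$ covariance matrix and $\pi^\star\in S_d$ an unknown permutation. One observes $X_1,\dots,X_m$ i.i.d. from $\mathcal N(0,\Sigma)$ and $Y_1,\dots,Y_n$ i.i.d. from $\mathcal N(0,\Sigma^{\pi^\star})$, the two samples being independent. Put $\widehat\Sigma_X=\frac1m\sum_{i=1}^mX_iX_i^\top$ and $\widehat\Sigma_Y=\frac1n\sum_{i=1}^nY_iY_i^\top$. Gromov--Wasserstein estimator: $\widehat\pi^{\mathsf{GW}}\in\arg\max_{\pi\in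 S_d}\langle\widehat\Sigma_X^{\pi},\widehat\Sigma_Y\rangle$, equivalently $\arg\min_{\pi\in S_d}\|\widehat\Sigma_X^\pi-\widehat\Sigma_Y\|_{\mathrm F}^2$ (any optimizer). *)

(* Defs.v *)
From HB Require Import structures.
From mathcomp Require Import all_boot all_order all_algebra all_fingroup.
From mathcomp Require Import all_classical all_reals all_analysis.
Import numFieldNormedType.Exports.

Set Implicit Arguments.
Unset Strict Implicit.
Unset Printing Implicit Defensive.

Import Order.TTheory GRing.Theory Num.Theory.

Local Open Scope classical_set_scope.
Local Open Scope ring_scope.

(** * Matrices *)

Section Matrices.
Variable R : realType.

Definition frob_inner m n (A B : 'M[R]_(m, n)) : R := \tr (A *m B^T).

(* On column vectors this is the Euclidean norm. *)
Definition frob_norm m n (A : 'M[R]_(m, n)) : R := Num.sqrt (frob_inner A A).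

(* Operator norm with respect to the Euclidean norms.  The set is nonempty
   (it contains 0) and bounded above by [frob_norm A], so [sup] is a genuine
   supremum. *)
Definition op_norm m n (A : 'M[R]_(m, n)) : R :=
  sup [set frob_norm (A *m x) | x in [set x : 'cV[R]_n | frob_norm x <= 1]].

Definition quad_form d (A : 'M[R]_d) (u : 'cV[R]_d) : R :=
  (u^T *m A *m u) 0 0.

Definition posdef d (A : 'M[R]_d) : Prop :=
  A^T = A /\ forall u : 'cV[R]_d, u != 0 -> 0 < quad_form A u.

(* [(conj_perm A s) i j = A (s i) (s j)] *)
Definition conj_perm d (A : 'M[R]_d) (s : 'S_d) : 'M[R]_d := mxsub s s A.

(* Uncentered empirical covariance [k^-1 * \sum_i x_i x_i^T]. *)
Definition emp_cov d k (x : 'I_k -> 'cV[R]_d) : 'M[R]_d :=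
  k%:R^-1 *: \sum_(i < k) x i *m (x i)^T.

Definition gw_optimizer d (SX SY : 'M[R]_d) (s : 'S_d) : Prop :=
  forall t : 'S_d,
    frob_inner (conj_perm SX t) SY <= frob_inner (conj_perm SX s) SY.

End Matrices.

(** * Gaussian random vectors *)

(* R^d with its Borel sigma-algebra; the carrier is convertible to
   ['cV[R]_d]. *)
Notation borel_cV R d := (g_sigma_algebraType (@open 'cV[R]_d)).

(* The law N(0, v) on R, for v >= 0.  The case v = 0 is treated separately
   because [normal_prob] is not a Dirac mass at standard deviation 0; note that
   the second parameter of [normal_prob] is the standard deviation. *)
Definition centered_normal (R : realType) (v : R)
    (A : set (measurableTypeR R)) : \bar R :=
  if v == 0 then dirac (0 : measurableTypeR R) A
  else normal_prob 0 (Num.sqrt v) A.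

(* [mu] is the law N(0, S) on R^d: every linear functional [x |-> u^T x] has
   law N(0, u^T S u) under [mu]. *)
Definition is_centered_gaussian (R : realType) d
    (mu : set (borel_cV R d) -> \bar R) (S : 'M[R]_d) : Prop :=
  forall (u : 'cV[R]_d) (A : set (measurableTypeR R)), measurable A ->
    mu ((fun x : 'cV[R]_d => (u^T *m x) 0 0) @^-1` A) =
    centered_normal (quad_form S u) A.

(** * Probability *)

Definition mutually_independent (R : realType) disp (T : measurableType disp)
    (P : probability T R) disp' (U : measurableType disp') (I : finType)
    (Z : I -> {RV P >-> U}) : Prop :=
  forall (J : {set I}) (A : I -> set U), (forall i, measurable (A i)) ->
    P (\bigcap_(i in [set` J]) (Z i @^-1` A i)) =
    (\prod_(i in J) P (Z i @^-1` A i))%E.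

(* Inner probability, so that no measurability of [A] is presupposed. *)
Definition with_prob_ge (R : realType) disp (T : measurableType disp)
    (P : probability T R) (p : R) (A : set T) : Prop :=
  exists E : set T, [/\ measurable E, E `<=` A & (p%:E <= P E)%E].

(* The covariance alignment model with [m] observations from N(0, S) and [n]
   observations from N(0, S^s), all [m + n] of them mutually independent. *)
Definition cov_alignment_model (R : realType) disp (T : measurableType disp)
    (P : probability T R) d m n (S : 'M[R]_d) (s : 'S_d)
    (X : 'I_m -> {RV P >-> borel_cV R d})
    (Y : 'I_n -> {RV P >-> borel_cV R d}) : Prop :=
  [/\ forall i, is_centered_gaussian (distribution P (X i)) S,
      forall j, is_centered_gaussian (distribution P (Y j)) (conj_perm S s) &
      mutually_independent
        (fun k : 'I_m + 'I_n =>
           match k with inl i => X i | inr j => Y j end)].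

(* Main.v *)
Require Import Defs.
From HB Require Import structures.
From mathcomp Require Import all_boot all_order all_algebra all_fingroup.
From mathcomp Require Import all_classical all_reals all_analysis.
From mathcomp Require Import measurable_realfun.
From mathcomp Require Import ring lra complex.
Import Order.TTheory GRing.Theory Num.Theory.
Import numFieldNormedType.Exports.
Local Open Scope classical_set_scope.
Local Open Scope ring_scope.

(** Let [E] and [F] be the errors of the two empirical covariances, let [p] be
    an optimizer, and let [D] be the Frobenius norm of
    [conj_perm Sigma p - conj_perm Sigma pistar].  Conjugation by a permutation
    is an isometry, so comparing the objective at [p] and at [pistar] gives
    (lemma [gw_basic_inequality])
    [D ^+ 2 / 2 <= <E, M> + <F, Delta> + <F, conj_perm E p - conj_perm E pistar>]
    where [Delta] is the difference that defines [D] and [M] is the same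
    difference in the coordinates of the first sample; both are deterministic
    given [p] and have norm [D].

    Each inner product of a covariance error with a fixed matrix of norm [N] is
    an average of centered quadratic forms in independent Gaussian vectors.  It
    has a subgaussian tail at scale [N / Num.sqrt k] for deviations of exponent
    [t <= k], [k] being the sample size ([cov_error_tail]).  A union bound over
    the [d`!] permutations costs [d * ln d] in the exponent, so the two linear
    terms are at most a constant times [D * Num.sqrt (t / minn m n)] with
    [t = d * ln d + ln (1 / delta)].  The cross term is treated in the same way
    after freezing the first sample, which is independent of the second one; it
    then only remains to control the norm of [E].  A net of the unit ball bounds
    the operator norm of [E] ([frob_inner_le_net]), and [frob_norm E ^+ 2] is at
    most [d] times the squared operator norm: this is where the factor
    [d * (d + ln (1 / delta))] comes from.  Absorbing the
    linear terms into [D ^+ 2] gives the rate.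

    Gaussian vectors are only known through their one-dimensional projections,
    so the exponential moments of quadratic forms are computed without any
    joint density.  For nonnegative coefficients, [expR (b * z ^+ 2 / 2)] is a
    Gaussian mixture of the functions [expR (t * z)], whose moments are given by
    the projections ([mgf_linear_squares]).  Negative coefficients are reduced
    to that case by bounding [expR (- y)] by a combination of exponentials of
    nonnegative multiples of [y] ([exp_square_majorant]).  Diagonalizing the
    quadratic form and the covariance simultaneously ([sym_diag_wrt_cov]) makes
    every Gaussian quadratic form a combination of such squares
    ([gaussian_quad_mgf]). *)

Set Implicit Arguments.
Unset Strict Implicit.
Unset Printing Implicit Defensive.

(** * Frobenius inner products and permuted coordinates *)

Section FrobeniusInner.
Variable R : realType.

Lemma frob_innerE m n (A B : 'M[R]_(m, n)) :
  frob_inner A B = \sum_i \sum_j A i j * B i j.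
Proof.
rewrite /frob_inner /mxtrace; apply: eq_bigr => i _; rewrite mxE.
by apply: eq_bigr => j _; rewrite mxE.
Qed.

Lemma frob_innerC m n (A B : 'M[R]_(m, n)) : frob_inner A B = frob_inner B A.
Proof.
by rewrite !frob_innerE; do 2 (apply: eq_bigr => ? _); rewrite mulrC.
Qed.

Lemma frob_innerDl m n (A B D : 'M[R]_(m, n)) :
  frob_inner (A + B) D = frob_inner A D + frob_inner B D.
Proof. by rewrite /frob_inner mulmxDl mxtraceD. Qed.

Lemma frob_innerZl m n a (A B : 'M[R]_(m, n)) :
  frob_inner (a *: A) B = a * frob_inner A B.
Proof. by rewrite /frob_inner -scalemxAl mxtraceZ. Qed.

Lemma frob_innerNl m n (A B : 'M[R]_(m, n)) :
  frob_inner (- A) B = - frob_inner A B.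
Proof. by rewrite /frob_inner mulNmx raddfN. Qed.

Lemma frob_innerBl m n (A B D : 'M[R]_(m, n)) :
  frob_inner (A - B) D = frob_inner A D - frob_inner B D.
Proof. by rewrite frob_innerDl frob_innerNl. Qed.

Lemma frob_innerDr m n (A B D : 'M[R]_(m, n)) :
  frob_inner D (A + B) = frob_inner D A + frob_inner D B.
Proof. by rewrite frob_innerC frob_innerDl !(frob_innerC D). Qed.

Lemma frob_innerBr m n (A B D : 'M[R]_(m, n)) :
  frob_inner D (A - B) = frob_inner D A - frob_inner D B.
Proof. by rewrite frob_innerC frob_innerBl !(frob_innerC D). Qed.

Lemma frob_innerZr m n a (A B : 'M[R]_(m, n)) :
  frob_inner A (a *: B) = a * frob_inner A B.
Proof. by rewrite frob_innerC frob_innerZl frob_innerC. Qed.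

Lemma frob_innerNr m n (A B : 'M[R]_(m, n)) :
  frob_inner A (- B) = - frob_inner A B.
Proof. by rewrite frob_innerC frob_innerNl frob_innerC. Qed.

Lemma frob_inner_suml m n I (r : seq I) (A : I -> 'M[R]_(m, n)) B :
  frob_inner (\sum_(i <- r) A i) B = \sum_(i <- r) frob_inner (A i) B.
Proof.
elim/big_ind2: _ => [|A1 a1 A2 a2 <- <-|//]; last exact: frob_innerDl.
by rewrite /frob_inner mul0mx raddf0.
Qed.

Lemma frob_inner_ge0 m n (A : 'M[R]_(m, n)) : 0 <= frob_inner A A.
Proof.
by rewrite frob_innerE; do 2 (apply: sumr_ge0 => ? _); rewrite -expr2 sqr_ge0.
Qed.

Lemma frob_norm_sqr m n (A : 'M[R]_(m, n)) : frob_norm A ^+ 2 = frob_inner A A.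
Proof. by rewrite sqr_sqrtr// frob_inner_ge0. Qed.

Lemma frob_norm_ge0 m n (A : 'M[R]_(m, n)) : 0 <= frob_norm A.
Proof. exact: sqrtr_ge0. Qed.

Lemma frob_inner_eq0 m n (A : 'M[R]_(m, n)) : (frob_inner A A == 0) = (A == 0).
Proof.
apply/idP/eqP => [|->]; last by rewrite /frob_inner mul0mx raddf0.
rewrite frob_innerE psumr_eq0; last first.
  by move=> i _; apply: sumr_ge0 => j _; rewrite -expr2 sqr_ge0.
move=> /allP A0; apply/matrixP => i j; have := A0 i (mem_index_enum _).
rewrite implyTb psumr_eq0; last by move=> k _; rewrite -expr2 sqr_ge0.
move=> /allP/(_ j (mem_index_enum _)).
by rewrite implyTb -expr2 sqrf_eq0 mxE => /eqP.
Qed.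

Lemma frob_inner_tr m n (A B : 'M[R]_(m, n)) :
  frob_inner A^T B^T = frob_inner A B.
Proof.
rewrite !frob_innerE exchange_big; do 2 (apply: eq_bigr => ? _).
by rewrite !mxE.
Qed.

Lemma frob_inner_mull m n p (A : 'M[R]_(m, n)) (B : 'M[R]_(n, p)) D :
  frob_inner (A *m B) D = frob_inner B (A^T *m D).
Proof. by rewrite /frob_inner trmx_mul trmxK mulmxA [RHS]mxtrace_mulC mulmxA. Qed.

Lemma frob_inner_mulr m n p (A : 'M[R]_(m, n)) (B : 'M[R]_(n, p)) D :
  frob_inner (A *m B) D = frob_inner A (D *m B^T).
Proof. by rewrite /frob_inner trmx_mul trmxK mulmxA. Qed.

Lemma frob_inner_cV n (x y : 'cV[R]_n) : frob_inner x y = \sum_i x i 0 * y i 0.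
Proof. by rewrite frob_innerE; apply: eq_bigr => i _; rewrite big_ord1. Qed.

Lemma quad_formE d (A : 'M[R]_d) (x : 'cV[R]_d) :
  quad_form A x = frob_inner (A *m x) x.
Proof.
rewrite /quad_form /frob_inner mxtrace_mulC mulmxA -mulmxA /mxtrace big_ord1.
by rewrite mulmxA.
Qed.

Lemma quad_form_frob d (A : 'M[R]_d) (x : 'cV[R]_d) :
  quad_form A x = frob_inner (x *m x^T) A.
Proof. by rewrite quad_formE frob_innerC frob_inner_mulr trmxK. Qed.

Lemma frob_inner_cols d (S : 'M[R]_d) n (Y : 'M[R]_(d, n)) :
  frob_inner (S *m Y) Y = \sum_j quad_form S (col j Y).
Proof.
rewrite frob_innerE exchange_big/=; apply: eq_bigr => j _.
rewrite quad_formE frob_inner_cV; apply: eq_bigr => i _.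
rewrite !mxE; congr (_ * _); apply: eq_bigr => k _; by rewrite !mxE.
Qed.

Lemma frob_inner_sub_le d (A B : 'M[R]_d) :
  frob_inner (A - B) (A - B) <= 2 * (frob_inner A A + frob_inner B B).
Proof.
have := frob_inner_ge0 (A + B).
rewrite frob_innerBl !frob_innerBr frob_innerDl !frob_innerDr (frob_innerC B A).
by lra.
Qed.

Lemma frob_inner_conj d (A B : 'M[R]_d) (s : 'S_d) :
  frob_inner (conj_perm A s) (conj_perm B s) = frob_inner A B.
Proof.
rewrite !frob_innerE [RHS](reindex_inj (@perm_inj _ s))/=.
apply: eq_bigr => i _; rewrite [RHS](reindex_inj (@perm_inj _ s))/=.
by apply: eq_bigr => j _; rewrite !mxE.
Qed.

Lemma conj_permM d (A : 'M[R]_d) (s t : 'S_d) :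
  conj_perm (conj_perm A s) t = conj_perm A (t * s)%g.
Proof. by apply/matrixP => i j; rewrite !mxE !permM. Qed.

Lemma conj_perm1 d (A : 'M[R]_d) : conj_perm A 1%g = A.
Proof. by apply/matrixP => i j; rewrite !mxE !perm1. Qed.

Lemma frob_inner_conjl d (A B : 'M[R]_d) (s : 'S_d) :
  frob_inner (conj_perm A s) B = frob_inner A (conj_perm B s^-1%g).
Proof.
by rewrite -(frob_inner_conj A _ s) conj_permM mulgV conj_perm1.
Qed.

Lemma conj_permD d (A B : 'M[R]_d) (s : 'S_d) :
  conj_perm (A + B) s = conj_perm A s + conj_perm B s.
Proof. by apply/matrixP => i j; rewrite !mxE. Qed.

Lemma conj_permB d (A B : 'M[R]_d) (s : 'S_d) :
  conj_perm (A - B) s = conj_perm A s - conj_perm B s.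
Proof. by apply/matrixP => i j; rewrite !mxE. Qed.

Lemma tr_conj_perm d (A : 'M[R]_d) (s : 'S_d) :
  (conj_perm A s)^T = conj_perm A^T s.
Proof. by apply/matrixP => i j; rewrite !mxE. Qed.

(** The permuted form is the original one in relabelled coordinates, hence it
    keeps positivity and upper bounds by the squared norm. *)
Lemma quad_form_conj d (A : 'M[R]_d) (s : 'S_d) (u : 'cV[R]_d) :
  quad_form (conj_perm A s) u =
  quad_form A (\col_i u ((s^-1)%g i) 0).
Proof.
rewrite !quad_form_frob -(frob_inner_conj _ A s); congr frob_inner.
apply/matrixP => i j; rewrite !mxE !big_ord1 !mxE.
by rewrite -!permM mulgV !perm1.
Qed.

Lemma conj_perm_sub_entry d (A : 'M[R]_d) (p s : 'S_d) i j :
  (conj_perm A p - conj_perm A s) i j = A (p i) (p j) - A (s i) (s j).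
Proof. by rewrite !mxE. Qed.

Lemma quad_form_conj_le d (S : 'M[R]_d) (s : 'S_d) :
  (forall u, quad_form S u <= frob_inner u u) ->
  forall u, quad_form (conj_perm S s) u <= frob_inner u u.
Proof.
move=> Sle u; rewrite quad_form_conj; apply: le_trans (Sle _) _.
rewrite !frob_inner_cV [leRHS](reindex_inj (@perm_inj _ s^-1%g))/=.
by apply: ler_sum => i _; rewrite !mxE.
Qed.

Lemma posdef_conj d (S : 'M[R]_d) (s : 'S_d) : posdef S -> posdef (conj_perm S s).
Proof.
move=> [Ssym Spos]; split; first by rewrite tr_conj_perm Ssym.
move=> u u0; rewrite quad_form_conj; apply: Spos; apply: contra u0 => /eqP v0.
apply/eqP/colP => i; move/colP/(_ (s i)): v0.
by rewrite !mxE -permM mulgV perm1.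
Qed.

End FrobeniusInner.

(** * Spectral theorem for real symmetric matrices *)

Section Spectral.
Variable R : realType.

(** Over [R[i]] there is an eigenvalue.  Symmetry forces its imaginary part to
    vanish, and then the real or the imaginary part of an eigenvector is a real
    eigenvector. *)
Lemma sym_real_eigenvector d (A : 'M[R]_d) : (0 < d)%N -> A^T = A ->
  exists (a : R) (v : 'cV[R]_d), frob_inner v v = 1 /\ A *m v = a *: v.
Proof.
move=> d0 As; pose AC := map_mx (@real_complex R) A.
have [l] := eigenvalue_closed AC d0.
move=> /eigenvalueP[z zA z0].
pose x := map_mx (@complex.Re R) z; pose y := map_mx (@complex.Im R) z.
pose a := complex.Re l; pose b := complex.Im l.
have ReM (p q : R[i]) : complex.Re (p * q) =
    complex.Re p * complex.Re q - complex.Im p * complex.Im q by case: p; case: q.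
have ImM (p q : R[i]) : complex.Im (p * q) =
    complex.Re p * complex.Im q + complex.Im p * complex.Re q by case: p; case: q.
have xA : x *m A = a *: x - b *: y.
  apply/rowP => j; move/rowP/(_ j)/(congr1 (@complex.Re R)): zA.
  rewrite !mxE raddf_sum/= => zA; under eq_bigr => k _ do rewrite mxE.
  transitivity (complex.Re (l * z 0 j)); last first.
    by rewrite ReM.
  rewrite -zA; apply: eq_bigr => k _; rewrite mxE.
  by case: (z 0 k) => p q /=; rewrite mulr0 subr0.
have yA : y *m A = a *: y + b *: x.
  apply/rowP => j; move/rowP/(_ j)/(congr1 (@complex.Im R)): zA.
  rewrite !mxE raddf_sum/= => zA; under eq_bigr => k _ do rewrite mxE.
  transitivity (complex.Im (l * z 0 j)); last first.
    by rewrite ImM.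
  rewrite -zA; apply: eq_bigr => k _; rewrite mxE.
  by case: (z 0 k) => p q /=; rewrite mulr0 add0r.
have xy0 : (x != 0) || (y != 0).
  rewrite -negb_and; apply: contra z0 => /andP[/eqP x0 /eqP y0].
  apply/eqP/rowP => j; move/rowP/(_ j): x0; move/rowP/(_ j): y0.
  by rewrite !mxE; case: (z 0 j) => ? ? /= -> ->.
have b0 : b = 0.
  have : frob_inner (x *m A) y = frob_inner (y *m A) x.
    by rewrite frob_inner_mulr As frob_innerC.
  rewrite xA yA frob_innerBl frob_innerDl !frob_innerZl (frob_innerC y x).
  move=> /eqP; rewrite -subr_eq0 => /eqP h.
  have /eqP : b * (frob_inner x x + frob_inner y y) = 0 by lra.
  rewrite mulf_eq0 => /orP[/eqP//|].
  rewrite paddr_eq0 ?frob_inner_ge0// !frob_inner_eq0.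
  by move=> /andP[/eqP x0 /eqP y0]; move: xy0; rewrite x0 y0 eqxx.
have key (u : 'rV[R]_d) : u != 0 -> u *m A = a *: u ->
    exists (a : R) (v : 'cV[R]_d), frob_inner v v = 1 /\ A *m v = a *: v.
  move=> u0 uA; exists a, ((frob_norm u)^-1 *: u^T); split.
    rewrite frob_innerZl frob_innerZr frob_inner_tr -frob_norm_sqr.
    have nu0 : frob_norm u != 0.
      by apply: contra u0; rewrite -frob_inner_eq0 -frob_norm_sqr sqrf_eq0.
    by rewrite mulrA -invfM -expr2 mulVf// expf_neq0.
  rewrite -scalemxAr scalerA mulrC -scalerA; congr (_ *: _).
  by rewrite -[A in LHS]As -trmx_mul uA linearZ.
case/orP: xy0 => [x0|y0].
  by apply: (key x) => //; rewrite xA b0 scale0r subr0.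
by apply: (key y) => //; rewrite yA b0 scale0r addr0.
Qed.

(** The Householder reflection that exchanges [v] and the first basis vector
    extends [v] to an orthonormal basis, which is what the deflation step of
    the spectral theorem needs. *)
Lemma orthogonal_completion d (v : 'cV[R]_(1 + d)) : frob_inner v v = 1 ->
  exists H : 'M[R]_(1 + d), [/\ H^T = H, H *m H = 1%:M & H *m delta_mx 0 0 = v].
Proof.
move=> v1; pose e : 'cV[R]_(1 + d) := delta_mx 0 0.
have [->|ve] := eqVneq v e.
  by exists 1%:M; rewrite trmx1 mulmx1 mul1mx.
pose w := v - e; pose c := frob_inner w w.
have c0 : c != 0 by rewrite /c frob_inner_eq0 subr_eq0.
have ee : frob_inner e e = 1.
  rewrite frob_inner_cV (bigD1 0)//= big1 ?addr0; first by rewrite mxE mulr1.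
  by move=> i /negPf i0; rewrite mxE i0 mul0r.
have ww : w^T *m w = c%:M.
  by rewrite [LHS]mx11_scalar -/c /c /frob_inner mxtrace_mulC /mxtrace big_ord1.
exists (1%:M - (2 / c) *: (w *m w^T)); split.
- by rewrite linearB/= trmx1 linearZ/= trmx_mul trmxK.
- rewrite mulmxBl mul1mx mulmxBr mulmx1 -scalemxAl -scalemxAr scalerA.
  rewrite mulmxA -(mulmxA w) ww mul_mx_scalar -scalemxAl scalerA.
  rewrite [X in _ - (_ - X *: _)](_ : _ = 2 / c + 2 / c); last by field.
  by rewrite scalerDl opprB addrK subrK.
- rewrite -/e mulmxBl mul1mx -scalemxAl -mulmxA.
  rewrite [w^T *m e]mx11_scalar (_ : (w^T *m e) 0 0 = - (c / 2)); last first.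
    rewrite (_ : (w^T *m e) 0 0 = frob_inner e w); last first.
      by rewrite /frob_inner mxtrace_mulC /mxtrace big_ord1.
    rewrite /c /w !frob_innerBl !frob_innerBr v1 ee (frob_innerC e v).
    by field.
  rewrite mul_mx_scalar scalerA.
  rewrite [X in X *: _](_ : _ = -1); last by field.
  by rewrite scaleN1r opprK /w addrC subrK.
Qed.

(** Deflation: in an orthonormal basis that starts with an eigenvector the
    matrix is block diagonal, with a block of size one. *)
Theorem sym_spectral d (A : 'M[R]_d) : A^T = A ->
  exists (Q : 'M[R]_d) (a : 'rV[R]_d),
    Q *m Q^T = 1%:M /\ A = Q^T *m diag_mx a *m Q.
Proof.
elim: d A => [|d IH] A As.
  by exists 1%:M, 0; split; apply/matrixP => -[].
have [a [v [v1 Av]]] := sym_real_eigenvector (ltn0Sn d) As.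
have [H [Hs HH He]] := orthogonal_completion v1.
have [B defB] : exists B : 'M[R]_(1 + d), B = H *m A *m H by eexists.
have Bs : B^T = B by rewrite defB !trmx_mul Hs As mulmxA.
have Be : B *m delta_mx 0 0 = a *: (delta_mx 0 0 : 'cV_(1 + d)).
  rewrite defB -mulmxA He -mulmxA Av -scalemxAr -He mulmxA HH mul1mx//.
have B0 i : B i 0 = a * (i == 0)%:R.
  have /matrixP/(_ i 0) := Be; rewrite !mxE eqxx andbT => <-.
  rewrite (bigD1 0)//= mxE big1 => [|j /negPf j0]; last first.
    by rewrite mxE j0 mulr0.
  by rewrite addr0 ?eqxx ?mulr1.
have lsh : lshift d (0 : 'I_1) = 0 by apply/val_inj.
have BE : B = block_mx a%:M 0 0 (drsubmx B).
  rewrite -[LHS]submxK; congr block_mx.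
  - apply/matrixP => i j; rewrite !ord1 !mxE lsh B0 eqxx mulr1.
    by rewrite mulr1n.
  - apply/matrixP => i j; rewrite !ord1 !mxE lsh.
    have -> : B 0 (rshift 1 j) = B (rshift 1 j) 0.
      by have /matrixP/(_ (rshift 1 j) 0) := Bs; rewrite mxE.
    by rewrite B0 mulr0.
  - by apply/matrixP => i j; rewrite !ord1 !mxE lsh B0 mulr0.
have [|Q [b [QQ QA]]] := IH (drsubmx B).
  by apply/matrixP => i j; rewrite !mxE -[in RHS]Bs mxE.
pose U : 'M[R]_(1 + d) := block_mx 1%:M 0 0 Q.
have UT : U^T = block_mx 1%:M 0 0 Q^T by rewrite /U tr_block_mx trmx1 !trmx0.
have UU : U *m U^T = 1%:M.
  rewrite UT /U mulmx_block.
  rewrite !mulmx0 !mul0mx !mul1mx !addr0 add0r QQ.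
  by rewrite -scalar_mx_block.
pose c : 'rV[R]_(1 + d) := row_mx (a%:M : 'rV_1) b.
have BU : B = U^T *m diag_mx c *m U.
  rewrite UT /c diag_mx_row /U !mulmx_block BE.
  rewrite !(mulmx0, mul0mx, mulmx1, mul1mx, addr0, add0r) -QA.
  congr block_mx.
  by apply/matrixP => i j; rewrite !ord1 !mxE.
exists (U *m H), c; split.
  by rewrite trmx_mul Hs mulmxA -(mulmxA U) HH mulmx1.
rewrite trmx_mul Hs -!mulmxA (mulmxA U^T) (mulmxA (U^T *m _)) -BU defB.
by rewrite !mulmxA HH mul1mx -mulmxA HH mulmx1.
Qed.

Lemma orthogonal_trmx d (Q : 'M[R]_d) : Q *m Q^T = 1%:M -> Q^T *m Q = 1%:M.
Proof. exact: mulmx1C. Qed.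

Lemma frob_inner_orthogonal d n (Q : 'M[R]_d) (x : 'M[R]_(d, n)) :
  Q *m Q^T = 1%:M -> frob_inner (Q *m x) (Q *m x) = frob_inner x x.
Proof.
by move=> /orthogonal_trmx QQ; rewrite frob_inner_mull mulmxA QQ mul1mx.
Qed.

Lemma quad_form_diag d (a : 'rV[R]_d) (x : 'cV[R]_d) :
  quad_form (diag_mx a) x = \sum_k a 0 k * x k 0 ^+ 2.
Proof.
rewrite quad_formE frob_inner_cV; apply: eq_bigr => k _.
by rewrite mul_diag_mx mxE expr2 mulrA.
Qed.

Lemma quad_form_congr d (W A : 'M[R]_d) (x : 'cV[R]_d) :
  quad_form (W^T *m A *m W) x = quad_form A (W *m x).
Proof. by rewrite /quad_form trmx_mul !mulmxA. Qed.

Lemma frob_inner_diag d (a : 'rV[R]_d) :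
  frob_inner (diag_mx a) (diag_mx a) = \sum_k a 0 k ^+ 2.
Proof.
rewrite frob_innerE; apply: eq_bigr => k _.
rewrite (bigD1 k)//= big1 ?addr0 => [|j /negPf jk].
  by rewrite !mxE eqxx mulr1n expr2.
by rewrite !mxE eq_sym jk mulr0n mul0r.
Qed.

Lemma frob_inner_spectral d (Q : 'M[R]_d) (a : 'rV[R]_d) : Q *m Q^T = 1%:M ->
  frob_inner (Q^T *m diag_mx a *m Q) (Q^T *m diag_mx a *m Q) =
  \sum_k a 0 k ^+ 2.
Proof.
move=> QQ; rewrite -frob_inner_diag -mulmxA.
rewrite frob_inner_orthogonal ?trmxK; last exact: orthogonal_trmx.
by rewrite frob_inner_mulr -mulmxA QQ mulmx1.
Qed.

(** Lagrange's identity: the difference of the two sides is half the sum of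
    the squares [(x i * y j - x j * y i) ^+ 2]. *)
Lemma cauchy_schwarz_sum (I : finType) (x y : I -> R) :
  (\sum_i x i * y i) ^+ 2 <= (\sum_i x i ^+ 2) * (\sum_i y i ^+ 2).
Proof.
have e : \sum_i \sum_j (x i * y j - x j * y i) ^+ 2 =
    (\sum_i x i ^+ 2) * (\sum_i y i ^+ 2) + (\sum_i y i ^+ 2) * (\sum_i x i ^+ 2)
    + (\sum_i -2 * (x i * y i)) * (\sum_i x i * y i).
  rewrite !big_distrlr/= -!big_split/=; apply: eq_bigr => i _.
  by rewrite -!big_split/=; apply: eq_bigr => j _; ring.
have : 0 <= \sum_i \sum_j (x i * y j - x j * y i) ^+ 2.
  by do 2 (apply: sumr_ge0 => ? _); exact: sqr_ge0.
by rewrite e -mulr_sumr expr2; lra.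
Qed.

Lemma cauchy_schwarz m n (A B : 'M[R]_(m, n)) :
  frob_inner A B ^+ 2 <= frob_inner A A * frob_inner B B.
Proof.
rewrite !frob_innerE !pair_bigA/=.
rewrite [X in _ <= X * _](eq_bigr (fun p => A p.1 p.2 ^+ 2)); last first.
  by move=> p _; rewrite expr2.
rewrite [X in _ <= _ * X](eq_bigr (fun p => B p.1 p.2 ^+ 2)); last first.
  by move=> p _; rewrite expr2.
exact: cauchy_schwarz_sum.
Qed.

Lemma frob_inner_mulmx_le m n p (A : 'M[R]_(m, n)) (B : 'M[R]_(n, p)) :
  frob_inner (A *m B) (A *m B) <= frob_inner A A * frob_inner B B.
Proof.
rewrite !frob_innerE [X in _ <= _ * X]exchange_big/=.
rewrite mulr_suml ler_sum// => i _; rewrite mulr_sumr ler_sum// => j _.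
rewrite -expr2 mxE; apply: le_trans (cauchy_schwarz_sum _ _) _.
by apply: ler_pM => //; do ?[by apply: sumr_ge0 => ? _; rewrite sqr_ge0];
  apply: ler_sum => k _; rewrite expr2.
Qed.

Lemma quad_form_le_op_norm d (S : 'M[R]_d) (x : 'cV[R]_d) : op_norm S <= 1 ->
  quad_form S x <= frob_inner x x.
Proof.
move=> S1; have [->|x0] := eqVneq x 0.
  by rewrite quad_formE mulmx0 /frob_inner mul0mx raddf0.
have nx0 : 0 < frob_norm x.
  rewrite lt_def frob_norm_ge0 andbT.
  by apply: contra x0; rewrite -frob_inner_eq0 -frob_norm_sqr sqrf_eq0.
have Sx : frob_norm (S *m x) <= frob_norm x.
  pose y := (frob_norm x)^-1 *: x.
  have y1 : frob_norm y = 1.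
    rewrite /frob_norm /y frob_innerZl frob_innerZr mulrA -expr2 -frob_norm_sqr.
    by rewrite -exprMn mulVf ?expr1n ?sqrtr1// gt_eqF.
  have -> : x = frob_norm x *: y by rewrite scalerA divff ?scale1r// gt_eqF.
  rewrite -scalemxAr.
  have nZ m (z : 'cV[R]_m) : frob_norm (frob_norm x *: z) =
      frob_norm x * frob_norm z.
    rewrite [LHS]/frob_norm frob_innerZl frob_innerZr mulrA -expr2.
    by rewrite sqrtrM ?sqr_ge0// sqrtr_sqr gtr0_norm.
  rewrite !nZ y1 ler_wpM2l//; first exact: ltW.
  apply: le_trans S1; apply: ub_le_sup; last by exists y => //=; rewrite y1.
  exists (frob_norm S) => _ [z /= z1 <-].
  rewrite ler_sqrt ?frob_inner_ge0//.
  apply: le_trans (frob_inner_mulmx_le _ _) _.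
  rewrite ler_piMr ?frob_inner_ge0// -frob_norm_sqr.
  by rewrite expr_le1 ?frob_norm_ge0.
rewrite quad_formE; apply: le_trans (ler_norm _) _.
rewrite -ler_sqr ?nnegrE ?frob_inner_ge0// real_normK ?num_real//.
apply: le_trans (cauchy_schwarz _ _) _; rewrite expr2 ler_wpM2r ?frob_inner_ge0//.
by rewrite -!frob_norm_sqr ler_sqr ?nnegrE ?frob_norm_ge0.
Qed.

(** If [S = L *m L^T] and [L^T *m M *m L = U^T *m diag_mx a *m U] with [U]
    orthogonal, then [W := (L^T)^-1 *m U^T] works.  The bound on the
    coefficients holds because multiplying [M] by the contractions [L^T] and
    [L] does not increase its norm.  Probabilistically, the columns of [W] are
    the directions along which a Gaussian vector of covariance [S] has standard
    coordinates. *)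
Theorem sym_diag_wrt_cov d (S M : 'M[R]_d) : posdef S -> M^T = M ->
  (forall u, quad_form S u <= frob_inner u u) ->
  exists (W : 'M[R]_d) (a : 'rV[R]_d),
    [/\ W^T *m S *m W = 1%:M, M = W *m diag_mx a *m W^T &
        \sum_k a 0 k ^+ 2 <= frob_inner M M].
Proof.
move=> [Ssym Spos] Msym Sle.
have [Q [s [QQ SE]]] := sym_spectral Ssym.
have QTQ := orthogonal_trmx QQ.
have s_gt0 k : 0 < s 0 k.
  have e0 : Q^T *m delta_mx k 0 != 0 :> 'cV_d.
    apply/eqP => /(congr1 (mulmx Q)); rewrite mulmxA QQ mul1mx mulmx0.
    by move/matrixP/(_ k 0); rewrite !mxE !eqxx => /eqP; rewrite oner_eq0.
  have := Spos _ e0; rewrite SE quad_form_congr mulmxA QQ mul1mx quad_form_diag.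
  rewrite (bigD1 k)//= mxE !eqxx expr1n mulr1 big1 ?addr0// => j /negPf jk.
  by rewrite mxE jk expr0n mulr0.
(* [L] and [G] are a square root of [S] and the inverse of its transpose. *)
pose r : 'rV[R]_d := \row_k Num.sqrt (s 0 k).
pose ri : 'rV[R]_d := \row_k (Num.sqrt (s 0 k))^-1.
have r_neq0 k : Num.sqrt (s 0 k) != 0 by rewrite gt_eqF// sqrtr_gt0.
have dd (b c : 'rV[R]_d) :
    diag_mx b *m diag_mx c = diag_mx (\row_k (b 0 k * c 0 k)).
  rewrite mul_diag_mx; apply/matrixP => i j; rewrite !mxE.
  by case: eqVneq => [->|]; rewrite ?mulr1n ?mulr0n ?mulr0.
have rr : diag_mx r *m diag_mx r = diag_mx s.
  rewrite dd; congr diag_mx; apply/rowP => k.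
  by rewrite !mxE -expr2 sqr_sqrtr// ltW.
have rri : diag_mx r *m diag_mx ri = 1%:M.
  rewrite dd -diag_const_mx; congr diag_mx; apply/rowP => k.
  by rewrite !mxE divff.
have rir : diag_mx ri *m diag_mx r = 1%:M by exact: mulmx1C.
pose L := Q^T *m diag_mx r; pose G := Q^T *m diag_mx ri.
have LT : L^T = diag_mx r *m Q by rewrite trmx_mul trmxK tr_diag_mx.
have GT : G^T = diag_mx ri *m Q by rewrite trmx_mul trmxK tr_diag_mx.
have SL : S = L *m L^T by rewrite LT /L SE -rr !mulmxA.
have LTG : L^T *m G = 1%:M.
  by rewrite LT /G mulmxA -(mulmxA _ Q) QQ mulmx1.
clearbody L G.
have GLT : G *m L^T = 1%:M by exact: mulmx1C.
have LGT : L *m G^T = 1%:M by rewrite -[LHS]trmxK trmx_mul trmxK GLT trmx1.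
have contract n (Y : 'M[R]_(d, n)) :
    frob_inner (L^T *m Y) (L^T *m Y) <= frob_inner Y Y.
  rewrite frob_inner_mull trmxK mulmxA -SL frob_innerC.
  rewrite frob_inner_cols -[X in frob_inner X _]mul1mx frob_inner_cols.
  by apply: ler_sum => j _; rewrite [leRHS]quad_formE mul1mx.
have NT : (L^T *m M *m L)^T = L^T *m M *m L.
  by rewrite !trmx_mul trmxK Msym mulmxA.
have [U [a [UU NE]]] := sym_spectral NT.
exists (G *m U^T), a; split.
- rewrite trmx_mul trmxK SL -!mulmxA (mulmxA L^T) LTG mul1mx.
  by rewrite (mulmxA G^T) -[G^T *m L]trmxK trmx_mul trmxK LTG trmx1 mul1mx.
- rewrite trmx_mul trmxK !mulmxA -(mulmxA G) -(mulmxA G) -NE.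
  by rewrite !mulmxA GLT mul1mx -mulmxA LGT mulmx1.
- rewrite -(frob_inner_spectral a UU) -NE -mulmxA.
  apply: le_trans (contract _ _) _.
  by rewrite -frob_inner_tr trmx_mul Msym contract.
Qed.

End Spectral.

(** * One-dimensional Gaussian integrals *)

Section Density.
Local Open Scope ereal_scope.
Import HBNNSimple.

(** Both sides agree on simple functions; monotone convergence does the rest. *)
Lemma ge0_integral_density d (T : measurableType d) (R : realType)
    (mu nu : {measure set T -> \bar R}) (g : T -> R) (f : T -> \bar R) :
  measurable_fun [set: T] g -> (forall x, 0 <= g x)%R ->
  (forall A, measurable A -> nu A = \int[mu]_(x in A) (g x)%:E) ->
  measurable_fun [set: T] f -> (forall x, 0 <= f x) ->
  \int[nu]_x f x = \int[mu]_x (f x * (g x)%:E).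
Proof.
move=> mg g0 nuE mf f0.
have mg' : measurable_fun [set: T] (EFin \o g) by exact/measurable_EFinP.
pose h := nnsfun_approx measurableT mf.
have cvgh x : EFin \o h^~ x @ \oo --> f x by exact: cvg_nnsfun_approx.
have ndh x : nondecreasing_seq (h^~ x).
  by move=> a b ab; exact/lefP/nd_nnsfun_approx.
transitivity (limn (fun n => \int[nu]_x (h n x)%:E)).
  rewrite -monotone_convergence//.
  - by apply: eq_integral => x _; apply/esym/cvg_lim => //; exact: cvgh.
  - by move=> n; exact/measurable_EFinP.
  - by move=> n x _; rewrite lee_fin.
  - by move=> x _ a b ab; rewrite lee_fin; exact: ndh.
transitivity (limn (fun n => \int[mu]_x ((h n x)%:E * (g x)%:E))); last first.
  rewrite -monotone_convergence//.
  - apply: eq_integral => x _; apply/cvg_lim => //.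
    by apply: cvgeZr => //; exact: cvgh.
  - by move=> n; apply: emeasurable_funM => //; exact/measurable_EFinP.
  - by move=> n x _; rewrite mule_ge0 ?lee_fin.
  - by move=> x _ a b ab; rewrite lee_wpmul2r ?lee_fin//; exact: ndh.
congr (limn _); apply/funext => n.
rewrite integralT_nnsfun sintegralE.
transitivity (\int[mu]_x \sum_(y \in range (h n))
    (y%:E * (\1_(h n @^-1` [set y]) x * g x)%:E)); last first.
  apply: eq_integral => x _; rewrite [in RHS](fimfunE (h n) x) -fsumEFin//.
  rewrite ge0_mule_fsuml; last by move=> y; exact: nnfun_muleindic_ge0.
  by apply: eq_fsbigr => y _; rewrite !EFinM muleA.
rewrite ge0_integral_fsum//.
- apply: eq_fsbigr => y; rewrite inE => -[t _ <-].
  rewrite ge0_integralZl//; last 3 first.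
  + by apply/measurable_EFinP; apply: measurable_funM => //.
  + by move=> x _; rewrite lee_fin mulr_ge0.
  + by rewrite lee_fin.
  congr (_ * _); rewrite nuE//.
  rewrite integral_mkcond; apply: eq_integral => x _.
  rewrite patchE indicE /=; case: ifPn => xA; first by rewrite mul1r.
  by rewrite mul0r.
- move=> y; apply: measurable_funeM; apply/measurable_EFinP.
  by apply: measurable_funM => //.
- move=> y x _; have := nnfun_muleindic_ge0 (h n) y x.
  by rewrite EFinM muleA => ?; rewrite mule_ge0 ?lee_fin.
Qed.

End Density.

Section GaussianIntegrals.
Variable R : realType.
Local Notation lambda := (@lebesgue_measure R).
Implicit Types (b s t x : R).

(** Completing the square: the integrand is a constant times the density with
    mean [t * s ^+ 2]. *)
Lemma integral_expR_normal_pdf t s : s != 0 ->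
  (\int[lambda]_x (expR (t * x) * normal_pdf 0 s x)%:E =
   (expR (t ^+ 2 * s ^+ 2 / 2))%:E)%E.
Proof.
move=> s0.
under eq_integral => x _ do
  (rewrite (_ : (_ * _) =
       expR (t ^+ 2 * s ^+ 2 / 2) * normal_pdf (t * s ^+ 2) s x);
   last (rewrite !normal_pdfE// /normal_fun mulrCA [RHS]mulrCA -!expRD;
         congr (_ * expR _); by field)).
under eq_integral do rewrite EFinM.
rewrite ge0_integralZl_EFin ?integral_normal_pdf ?mule1 ?expR_ge0//.
- by move=> x _; rewrite lee_fin normal_pdf_ge0.
- by apply/measurable_EFinP; exact: measurable_normal_pdf.
Qed.

(** The integrand is a multiple of the centered normal density with variance
    [(1 - b)^-1]. *)
Lemma integral_expR_sqr_normal_pdf b : 0 <= b < 1 ->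
  (\int[lambda]_x (expR (b / 2 * x ^+ 2) * normal_pdf 0 1 x)%:E =
   ((Num.sqrt (1 - b))^-1)%:E)%E.
Proof.
move=> /andP[b0 b1]; pose s : R := (Num.sqrt (1 - b))^-1.
have b1' : 0 < 1 - b by rewrite subr_gt0.
have s0 : 0 < s by rewrite invr_gt0 sqrtr_gt0.
have s2 : s ^+ 2 = (1 - b)^-1 by rewrite exprVn sqr_sqrtr// ltW.
have expE x : b / 2 * x ^+ 2 + - (x - 0) ^+ 2 / (1 ^+ 2 *+ 2) =
    - (x - 0) ^+ 2 / (s ^+ 2 *+ 2).
  by rewrite s2; field; rewrite gt_eqF.
have peakE : normal_peak 1 = s * normal_peak s.
  rewrite /normal_peak expr1n mul1r -[in RHS]mulrnAr sqrtrM ?sqr_ge0//.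
  by rewrite sqrtr_sqr gtr0_norm// invfM mulrA divff ?mul1r// gt_eqF.
under eq_integral => x _ do
  (rewrite (_ : (_ * _) = s * normal_pdf 0 s x); last
   (rewrite !normal_pdfE ?oner_neq0 ?gt_eqF// /normal_fun mulrCA -expRD [RHS]mulrA;
    congr (_ * expR _);
    [exact: peakE
    |exact: expE])).
under eq_integral do rewrite EFinM.
rewrite ge0_integralZl_EFin ?integral_normal_pdf ?mule1 ?ltW//.
- by move=> x _; rewrite lee_fin normal_pdf_ge0.
- by apply/measurable_EFinP; exact: measurable_normal_pdf.
Qed.

End GaussianIntegrals.

(** * Exponential moments of squares of standard Gaussians *)

Section Majorant.
Variable R : realType.

Lemma invsqrt_upper (a : R) : 0 <= a <= 4^-1 ->
  (Num.sqrt (1 - 2 * a))^-1 <= 1 + a + 4 * a ^+ 2.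
Proof.
move=> /andP[a0 a1].
have q0 : 0 < 1 + a + 4 * a ^+ 2 by have := sqr_ge0 a; lra.
have s0 : 0 < Num.sqrt (1 - 2 * a) by rewrite sqrtr_gt0; lra.
rewrite -[leLHS]mul1r ler_pdivrMr//.
rewrite -ler_sqr ?nnegrE ?mulr_ge0 ?(ltW q0) ?(ltW s0)//.
rewrite expr1n exprMn sqr_sqrtr; last by lra.
have a2 : a ^+ 2 * (5 - 10 * a - 32 * a ^+ 3) >= 0.
  apply: mulr_ge0; first exact: sqr_ge0.
  have : a ^+ 3 <= 4^-1 ^+ 3 by rewrite lerXn2r ?nnegrE//; lra.
  by lra.
rewrite -subr_ge0; apply: le_trans a2 _; lra.
Qed.

Lemma invsqrt_lower (a : R) : 0 <= a < 1 ->
  1 + a / 2 <= (Num.sqrt (1 - a))^-1.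
Proof.
move=> /andP[a0 a1].
have s0 : 0 < Num.sqrt (1 - a) by rewrite sqrtr_gt0; lra.
rewrite -[leRHS]mul1r ler_pdivlMr//.
rewrite -ler_sqr ?nnegrE ?mulr_ge0 ?(ltW s0)//; last by lra.
rewrite expr1n exprMn sqr_sqrtr; last by lra.
have := sqr_ge0 a; have : 0 <= a * a ^+ 2 by rewrite mulr_ge0// sqr_ge0.
nra.
Qed.

(** For [c >= 0] nothing has to be done.  For [c = - a] the majorant is
    [3 - 3 * v + v ^+ 2] with [v = expR (a * y)]; it dominates [v^-1] because
    [(v - 1) ^+ 3 >= 0].  Its coefficients are such that the Gaussian average of
    the majorant agrees with [expR (c / 2)] to first order in [c], so only a
    quadratic error is left.  The third item is that average, for [y] half the
    square of a standard Gaussian; it is nonnegative, which allows one to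
    multiply such bounds. *)
Lemma exp_square_majorant (c : R) : `|c| <= 4^-1 ->
  exists gb : ('I_3 -> R) * ('I_3 -> R),
  [/\ forall j, 0 <= gb.2 j < 1,
      forall y, 0 <= y -> expR (c * y) <= \sum_j gb.1 j * expR (gb.2 j * y) &
      0 <= \sum_j gb.1 j * (Num.sqrt (1 - gb.2 j))^-1
        <= expR (c / 2 + 4 * c ^+ 2)].
Proof.
move=> c4; have [c0|c0] := leP 0 c.
  rewrite ger0_norm// in c4.
  exists (fun j : 'I_3 => [:: 1; 0; 0]`_j, fun=> c); split => /=.
  - by move=> _; rewrite c0/=; lra.
  - by move=> y y0; rewrite !big_ord_recl big_ord0/= !mul0r !addr0 mul1r.
  - rewrite !big_ord_recl big_ord0/= !mul0r !addr0 mul1r.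
    rewrite invr_ge0 sqrtr_ge0/=; apply: le_trans (expR_ge1Dx _).
    have := @invsqrt_upper (c / 2); rewrite mulrCA divff// mulr1 => H.
    by apply: le_trans (H _) _; [lra|have := sqr_ge0 c; lra].
pose a := - c; have cE : c = - a by rewrite opprK.
rewrite ltr0_norm// -/a in c4; have a0 : 0 < a by rewrite oppr_gt0.
rewrite {}cE {c0}; move: a a0 c4 => {c}a a0 a4.
exists (fun j : 'I_3 => [:: 3; -3; 1]`_j, fun j : 'I_3 => a *+ j).
split => /=.
- move=> j; rewrite mulrn_wge0 ?ltW//=.
  have := ltn_ord j; rewrite ltnS => j2.
  have : a *+ j <= a *+ 2 by rewrite ler_pMn2l.
  by rewrite -[_ *+ 2]mulr_natr; lra.
- move=> y y0; rewrite !big_ord_recl big_ord0/= /bump/= ?addn0.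
  rewrite mulr0n mul0r expR0 mulr1n addr0 mulr1.
  rewrite (_ : (_ + _)%N = 2%N)// mulr2n mulrDl expRD mulNr expRN.
  set v := expR (a * y); have v1 : 1 <= v.
    by apply: le_trans (expR_ge1Dx _); rewrite lerDl mulr_ge0// ltW.
  have v0 : 0 < v by lra.
  rewrite -[leLHS]mul1r ler_pdivrMr//.
  have : 0 <= (v - 1) ^+ 3 by rewrite exprn_ge0// subr_ge0.
  by rewrite !exprS expr0; lra.
- rewrite !big_ord_recl big_ord0/= /bump/= (_ : (1 + 1)%N = 2%N)// ?addn0.
  rewrite mulr0n subr0 sqrtr1 invr1 mulr1n addr0 mulr1 mul1r.
  have := @invsqrt_upper (a / 2); rewrite mulrCA divff// mulr1.
  have := @invsqrt_upper a; have := @invsqrt_lower a; have := @invsqrt_lower (2 * a).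
  rewrite -(mulr_natl a 2) sqrrN => /(_ _)/wrap[]; first by lra.
  move=> + /(_ _)/wrap[]; first by lra.
  move=> + + /(_ _)/wrap[]; first by lra.
  move=> + + + /(_ _)/wrap[]; first by lra.
  have a2 : a ^+ 2 <= 4^-1 * a by rewrite expr2 ler_pM2r.
  move=> H1 H2 H3 H4; apply/andP; split; first by lra.
  apply: le_trans (expR_ge1Dx _); lra.
Qed.

End Majorant.

Section StandardGaussianFamily.
Context (R : realType) disp (T : measurableType disp) (P : probability T R).
Context (d : nat) (z : 'I_d -> T -> R).
Hypothesis mz : forall k, measurable_fun [set: T] (z k).
Hypothesis mgf : forall t : 'I_d -> R,
  (\int[P]_w (expR (\sum_k t k * z k w))%:E =
   \prod_k (expR (t k ^+ 2 / 2))%:E)%E.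
Local Notation lambda := (@lebesgue_measure R).

(** The factor contributed by a coordinate with linear coefficient [t] and
    quadratic coefficient [b]; it stays an integral because a closed form is
    only needed at [t = 0]. *)
Definition smoothed_exp_sqr (b t : R) : \bar R :=
  (\int[lambda]_x (expR ((t + Num.sqrt b * x) ^+ 2 / 2) * normal_pdf 0 1 x)%:E)%E.

Lemma smoothed_exp_sqr_ge0 b t : (0 <= smoothed_exp_sqr b t)%E.
Proof.
by apply: integral_ge0 => x _; rewrite lee_fin mulr_ge0 ?expR_ge0 ?normal_pdf_ge0.
Qed.

Lemma measurable_linear (t : 'I_d -> R) (r : seq 'I_d) :
  measurable_fun [set: T] (fun w => \sum_(k <- r) t k * z k w).
Proof. by apply: measurable_sum => k; exact: measurable_funM. Qed.

Lemma measurable_squares (b : 'I_d -> R) (r : seq 'I_d) :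
  measurable_fun [set: T] (fun w => \sum_(k <- r) b k / 2 * z k w ^+ 2).
Proof.
apply: measurable_sum => k; apply: measurable_funM => //.
exact: measurable_funX.
Qed.

(** Induction on the number of squares.  For the square of [z j], write
    [expR (b j / 2 * z j w ^+ 2)] as the average of
    [expR (Num.sqrt (b j) * z j w * x)] over a standard Gaussian [x] and
    exchange the integrals: inside, the square has become a shift of the linear
    coefficient [t j].  This is why arbitrary linear terms are carried along. *)
Lemma mgf_linear_squares (b : 'I_d -> R) (r : seq 'I_d) :
  (forall k, 0 <= b k) -> uniq r -> forall t : 'I_d -> R,
  (\int[P]_w (expR (\sum_k t k * z k w + \sum_(k <- r) b k / 2 * z k w ^+ 2))%:E
   = (\prod_(k | k \notin r) (expR (t k ^+ 2 / 2))%:E)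
     * \prod_(k <- r) smoothed_exp_sqr (b k) (t k))%E.
Proof.
move=> b0; elim: r => [_ t|j r IH /= /andP[jr ur] t].
  rewrite big_nil mule1; under eq_integral do rewrite big_nil addr0.
  by rewrite mgf.
pose t' x k := if k == j then t j + Num.sqrt (b j) * x else t k.
pose B w := \sum_(k <- r) b k / 2 * z k w ^+ 2.
pose f (p : T * R) : \bar R :=
  (expR (\sum_k t k * z k p.1 + B p.1 + Num.sqrt (b j) * z j p.1 * p.2)
   * normal_pdf 0 1 p.2)%:E.
have f0 p : (0 <= f p)%E by rewrite lee_fin mulr_ge0 ?expR_ge0 ?normal_pdf_ge0.
have mB : measurable_fun [set: T] B by exact: measurable_squares.
have mf : measurable_fun [set: T * R] f.
  apply/measurable_EFinP; apply: measurable_funM; last first.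
    by apply: (measurableT_comp (measurable_normal_pdf _ _)) => //.
  apply: measurableT_comp => //; apply: measurable_funD.
    apply: measurable_funD.
      exact: (measurableT_comp (measurable_linear t _)).
    exact: (measurableT_comp mB).
  apply: measurable_funM => //; apply: measurable_funM => //.
  exact: (measurableT_comp (mz j)).
transitivity (\int[P]_w \int[lambda]_x f (w, x))%E.
  apply: eq_integral => w _; rewrite big_cons.
  rewrite (_ : _ + _ = (\sum_k t k * z k w + B w) + b j / 2 * z j w ^+ 2);
    last by rewrite -/(B w); ring.
  rewrite expRD /f /=.
  under [RHS]eq_integral do rewrite expRD -mulrA EFinM.
  rewrite ge0_integralZl_EFin ?expR_ge0//.
  - rewrite integral_expR_normal_pdf ?oner_neq0// -EFinM expr1n mulr1 exprMn.
    by rewrite sqr_sqrtr// mulrAC.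
  - by move=> x _; rewrite lee_fin mulr_ge0 ?expR_ge0 ?normal_pdf_ge0.
  - apply/measurable_EFinP; apply: measurable_funM.
      by apply: measurableT_comp => //; exact: measurable_funM.
    exact: measurable_normal_pdf.
transitivity (\int[lambda]_x \int[P]_w f (w, x))%E.
  exact: (@fubini_tonelli _ _ _ _ _ P lambda f mf f0).
pose c : \bar R := ((\prod_(k | k \notin j :: r) (expR (t k ^+ 2 / 2))%:E)
     * \prod_(k <- r) smoothed_exp_sqr (b k) (t k))%E.
have c0 : (0 <= c)%E.
  apply: mule_ge0; first by apply: prode_ge0 => k _; rewrite lee_fin expR_ge0.
  by apply: prode_ge0 => k _; exact: smoothed_exp_sqr_ge0.
transitivity (\int[lambda]_x (c *
    (expR ((t j + Num.sqrt (b j) * x) ^+ 2 / 2) * normal_pdf 0 1 x)%:E))%E.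
  apply: eq_integral => x _; rewrite /f/=.
  transitivity (\int[P]_w ((normal_pdf 0 1 x)%:E *
      (expR (\sum_k t' x k * z k w + B w))%:E))%E.
    apply: eq_integral => w _; rewrite -EFinM mulrC; congr (_ * expR _)%:E.
    rewrite addrAC; congr (_ + _).
    rewrite (bigD1 j)//= [in RHS](bigD1 j)//= /t' eqxx.
    rewrite (eq_bigr (fun k =>
      (if k == j then t j + Num.sqrt (b j) * x else t k) * z k w)).
      by ring.
    by move=> k /negPf ->.
  rewrite ge0_integralZl_EFin ?normal_pdf_ge0//.
  - have smoothE : (\prod_(k <- r) smoothed_exp_sqr (b k) (t' x k) =
        \prod_(k <- r) smoothed_exp_sqr (b k) (t k))%E.
      apply: eq_big_seq => k kr.
      have /negPf kj : k != j by apply: contraNneq jr => <-.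
      by rewrite /t' kj.
    have linE : (\prod_(k | (k \notin r) && (k != j)) (expR (t' x k ^+ 2 / 2))%:E =
        \prod_(k | k \notin j :: r) (expR (t k ^+ 2 / 2))%:E)%E.
      apply: eq_big => k; first by rewrite in_cons negb_or andbC.
      by move=> /andP[_ /negPf kj]; rewrite /t' kj.
    rewrite IH// (bigD1 j)//= {1}/t' eqxx.
    rewrite linE smoothE -(muleA (expR _)%:E) -/c EFinM muleA muleC.
    by rewrite (muleC (normal_pdf _ _ _)%:E).
  - apply/measurable_EFinP/measurableT_comp => //.
    by apply: measurable_funD => //; exact: measurable_linear.
rewrite ge0_integralZl//.
- rewrite /c big_cons -/(smoothed_exp_sqr (b j) (t j)) -muleA.
  by rewrite (muleC (smoothed_exp_sqr _ _)).
- apply/measurable_EFinP; apply: measurable_funM; last first.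
    exact: measurable_normal_pdf.
  apply: measurableT_comp => //; apply: measurable_funM => //.
  by apply: measurable_funX; apply: measurable_funD => //; apply: measurable_funM.
- by move=> x _; rewrite lee_fin mulr_ge0 ?expR_ge0 ?normal_pdf_ge0.
Qed.

Lemma mgf_squares (b : 'I_d -> R) : (forall k, 0 <= b k < 1) ->
  (\int[P]_w (expR (\sum_k b k / 2 * z k w ^+ 2))%:E
   = (\prod_k (Num.sqrt (1 - b k))^-1)%:E)%E.
Proof.
move=> b01.
have := @mgf_linear_squares b (index_enum 'I_d) (fun k => (andP (b01 k)).1)
   (index_enum_uniq _) (fun=> 0).
rewrite [X in (_ = X * _)%E -> _]big_pred0; last first.
  by move=> k; rewrite mem_index_enum.
rewrite mul1e -prodEFin => H.
transitivity (\int[P]_w (expR (\sum_k 0 * z k w +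
    \sum_k b k / 2 * z k w ^+ 2))%:E)%E.
  apply: eq_integral => w _; rewrite [X in _ = (expR (X + _))%:E]big1 ?add0r//.
  by move=> k _; rewrite mul0r.
rewrite H; apply: eq_bigr => k _; have /andP[bk0 bk1] := b01 k.
rewrite -integral_expR_sqr_normal_pdf ?bk0//; apply: eq_integral => x _.
by rewrite add0r exprMn sqr_sqrtr// mulrAC.
Qed.

(** Replace each factor by its majorant, expand the product over all choices of
    one exponential per coordinate, integrate, and factor the sum back.  The
    integral is thus computed as if the coordinates were independent. *)
Lemma mgf_signed_squares (c : 'I_d -> R) : (forall k, `|c k| <= 4^-1) ->
  (\int[P]_w (expR (\sum_k c k / 2 * z k w ^+ 2))%:E
   <= (expR (\sum_k (c k / 2 + 4 * c k ^+ 2)))%:E)%E.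
Proof.
move=> c4.
have /choice[gb gbP] := fun k => exp_square_majorant (c4 k).
pose g k := (gb k).1; pose b k := (gb k).2.
pose q f w := \sum_k b k (f k) / 2 * z k w ^+ 2.
have mq (f : {ffun 'I_d -> 'I_3}) :
    measurable_fun [set: T] (fun w => expR (q f w)).
  by apply: measurableT_comp => //; exact: (measurable_squares (fun k => b k (f k))).
have intq (f : {ffun 'I_d -> 'I_3}) : (\int[P]_w (expR (q f w))%:E =
    (\prod_k (Num.sqrt (1 - b k (f k)))^-1)%:E)%E.
  by apply: mgf_squares => k; have [gb1 _ _] := gbP k; exact: gb1.
have iq (f : {ffun 'I_d -> 'I_3}) :
    P.-integrable [set: T] (fun w => (expR (q f w))%:E).
  apply/integrableP; split; first by apply/measurable_EFinP; exact: mq.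
  under eq_integral do rewrite /= ger0_norm ?expR_ge0//.
  by rewrite intq ltry.
have igq (f : {ffun 'I_d -> 'I_3}) :
    P.-integrable [set: T] (fun w => (\prod_k g k (f k))%:E * (expR (q f w))%:E)%E.
  exact: integrableZl.
apply: (@le_trans _ _ (\int[P]_w (\sum_(f : {ffun 'I_d -> 'I_3})
    (\prod_k g k (f k))%:E * (expR (q f w))%:E))%E).
  apply: ge0_le_integral => //.
  - apply/measurable_EFinP; apply: measurableT_comp => //.
    exact: measurable_squares.
  - by apply: emeasurable_sum => f _; apply: (measurable_int P).
  - move=> w _; under [leRHS]eq_bigr do rewrite -EFinM.
    rewrite sumEFin lee_fin.
    rewrite expR_sum.
    rewrite (eq_bigr (fun f : {ffun 'I_d -> 'I_3} =>
       \prod_k (g k (f k) * expR (b k (f k) * (z k w ^+ 2 / 2))))).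
      rewrite -(bigA_distr_bigA (fun k j => g k j * expR (b k j * (z k w ^+ 2 / 2)))).
      apply: ler_prod => k _; rewrite expR_ge0/=.
      have [_ + _] := gbP k => /(_ (z k w ^+ 2 / 2)).
      rewrite (_ : c k / 2 * _ = c k * (z k w ^+ 2 / 2)); last by ring.
      by apply; rewrite divr_ge0// sqr_ge0.
    move=> f _; rewrite /q expR_sum -big_split/=; apply: eq_bigr => k _.
    by congr (_ * expR _); ring.
rewrite integral_sum//.
rewrite (eq_bigr (fun f : {ffun 'I_d -> 'I_3} =>
    (\prod_k (g k (f k) * (Num.sqrt (1 - b k (f k)))^-1))%:E)); last first.
  by move=> f _; rewrite integralZl// intq -EFinM big_split.
rewrite sumEFin lee_fin.
rewrite -(bigA_distr_bigA (fun k j => g k j * (Num.sqrt (1 - b k j))^-1)) expR_sum.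
by apply: ler_prod => k _; have [] := gbP k.
Qed.

End StandardGaussianFamily.

(** * Independent sigma-algebras *)

Section IndependentSystems.
Local Open Scope ereal_scope.
Context (R : realType) disp (T : measurableType disp) (P : probability T R).

(** The sets [A] that satisfy the product rule with [B] form a Dynkin system. *)
Lemma indep_sigma_l (G : set (set T)) (B : set T) :
  setI_closed G -> G `<=` measurable -> measurable B ->
  (forall A, G A -> P (A `&` B) = P A * P B) ->
  forall A, <<s G >> A -> P (A `&` B) = P A * P B.
Proof.
move=> GI Gm mB PG A sA.
pose H := [set A : set T | measurable A /\ P (A `&` B) = P A * P B].
suff : <<s G >> `<=` H by move=> /(_ A sA)[].
apply: (lambda_system_subset GI) => //; last first.
  by move=> C GC; split; [exact: Gm|exact: PG].
apply/dynkin_lambda_system; split.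
- by split => //; rewrite setTI probability_setT mul1e.
- move=> C [mC PC]; split; first exact: measurableC.
  rewrite probability_setC// setIC -setDE.
  rewrite measureD ?ltey_eq ?fin_num_measure//.
  rewrite [X in _ - X](_ : _ = P C * P B); last by rewrite -PC setIC.
  rewrite muleBl ?mul1e ?fin_num_measure//.
- move=> F tF HF; have mF n : measurable (F n) by have [] := HF n.
  split; first exact: bigcup_measurable.
  rewrite setI_bigcupl !measure_bigcup//=.
  + have /fineK <- : P B \is a fin_num by rewrite fin_num_measure.
    rewrite muleC -nneseriesZl//; apply: eq_eseriesr => n _.
    have [_ ->] := HF n; rewrite muleC; congr (_ * _).
    by rewrite fineK// fin_num_measure.
  + by move=> n _; exact: measurableI.
  + exact: trivIset_setIr.
Qed.

Variables G1 G2 : set (set T).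
Hypothesis G1I : setI_closed G1.
Hypothesis G2I : setI_closed G2.
Hypothesis G1m : G1 `<=` measurable.
Hypothesis G2m : G2 `<=` measurable.
Hypothesis G12 : forall A B, G1 A -> G2 B -> P (A `&` B) = P A * P B.

Let sub_measurable (G : set (set T)) : G `<=` measurable ->
  <<s G >> `<=` @measurable _ T.
Proof.
by move=> Gm; apply: smallest_sub => //; exact: sigma_algebra_measurable.
Qed.

Lemma indep_sigma A B : <<s G1 >> A -> <<s G2 >> B ->
  P (A `&` B) = P A * P B.
Proof.
move=> sA sB; rewrite setIC muleC.
apply: (indep_sigma_l G2I) => //; first exact: sub_measurable sA.
move=> C GC; rewrite setIC muleC.
by apply: (indep_sigma_l G1I) => //; [exact: G2m|move=> D GD; exact: G12].
Qed.

Local Notation V1 := (g_sigma_algebraType G1).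
Local Notation V2 := (g_sigma_algebraType G2).

(* On [V1] and [V2] the carrier is still [T]: the diagonal map sends [P] to the
   product of its restrictions to the two sigma-algebras, which gives access to
   the Fubini theorem without any space of values. *)
Let mid1 : measurable_fun [set: T] (id : T -> V1).
Proof. by move=> _ A mA; rewrite setTI; exact: sub_measurable mA. Qed.
Let mid2 : measurable_fun [set: T] (id : T -> V2).
Proof. by move=> _ A mA; rewrite setTI; exact: sub_measurable mA. Qed.
Let mdiag : measurable_fun [set: T] (fun w => (w, w) : V1 * V2).
Proof. exact: measurable_fun_pair. Qed.

Let id1 : {mfun T >-> V1} :=
  let m := isMeasurableFun.Build _ _ _ _ _ mid1 in HB.pack (id : T -> V1) m.
Let id2 : {mfun T >-> V2} :=
  let m := isMeasurableFun.Build _ _ _ _ _ mid2 in HB.pack (id : T -> V2) m.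
Let diag : {mfun T >-> (V1 * V2)%type} :=
  let m := isMeasurableFun.Build _ _ _ _ _ mdiag in
  HB.pack (fun w => (w, w) : V1 * V2) m.

Let product_diag (Q : set (V1 * V2)) : measurable Q ->
  (distribution P id1 \x distribution P id2) Q = distribution P diag Q.
Proof.
apply: product_measure_unique => A B mA mB.
exact: indep_sigma.
Qed.

Lemma measurable_diag (Q : set (V1 * V2)) : measurable Q ->
  measurable [set w : T | Q (w, w)].
Proof. by move=> mQ; rewrite -[X in measurable X]setTI; exact: mdiag. Qed.

(** Freezing the component that is measurable for the first sigma-algebra: if
    the conditional bound holds for every frozen value, it holds on the
    diagonal. *)
Lemma indep_diag_le (Q : set (V1 * V2)) (c : R) : measurable Q ->
  (forall w, P [set w' : T | Q (w, w')] <= c%:E) ->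
  P [set w : T | Q (w, w)] <= c%:E.
Proof.
move=> mQ Qc; rewrite -[X in X <= _]/(distribution P diag Q) -product_diag//.
apply: (@le_trans _ _ (\int[distribution P id1]_w (cst c%:E) w)).
  apply: ge0_le_integral => //; first exact: measurable_fun_xsection.
  move=> w _; apply: le_trans (Qc w).
  rewrite le_eqVlt; apply/orP; left; apply/eqP; congr (P _).
  by apply/seteqP; split => x /=; rewrite /xsection/= ?inE.
by rewrite integral_cst// [X in _ * X]probability_setT mule1.
Qed.

Lemma indep_expectation (f : V1 -> \bar R) (g : V2 -> \bar R) :
  measurable_fun [set: V1] f -> (forall w, 0 <= f w) ->
  measurable_fun [set: V2] g -> (forall w, 0 <= g w) ->
  \int[P]_w (f w * g w) = (\int[P]_w f w) * (\int[P]_w g w).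
Proof.
move=> mf f0 mg g0.
pose h (p : V1 * V2) := f p.1 * g p.2.
have h0 p : 0 <= h p by exact: mule_ge0.
have mh : measurable_fun [set: V1 * V2] h.
  by apply: emeasurable_funM; exact: measurableT_comp.
transitivity (\int[distribution P diag]_p h p).
  by rewrite ge0_integral_distribution.
transitivity (\int[distribution P id1 \x distribution P id2]_p h p).
  by apply: eq_measure_integral => A mA _; exact: esym (product_diag mA).
rewrite fubini_tonelli1//.
under eq_integral => x _.
  rewrite /fubini_F /h/= ge0_integralZl//.
  over.
rewrite ge0_integralZr// ?integral_ge0//.
by congr (_ * _); rewrite ge0_integral_distribution.
Qed.

End IndependentSystems.

Section MutualIndependence.
Local Open Scope ereal_scope.
Context (R : realType) disp (T : measurableType disp) (P : probability T R).
Context disp' (U : measurableType disp') (I : finType) (Z : I -> {RV P >-> U}).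

Definition cylinders (J : {set I}) : set (set T) :=
  [set C | exists A : I -> set U, (forall i, measurable (A i)) /\
     C = \bigcap_(i in [set` J]) (Z i @^-1` A i)].

Local Notation sigmaType J := (g_sigma_algebraType (cylinders J)).

Lemma cylinders_setI (J : {set I}) : setI_closed (cylinders J).
Proof.
move=> _ _ [A [mA ->]] [B [mB ->]].
exists (fun i => A i `&` B i); split; first by move=> i; exact: measurableI.
by rewrite -bigcapI; apply: eq_bigcapr => i _; rewrite preimage_setI.
Qed.

Lemma cylinders_measurable (J : {set I}) : cylinders J `<=` measurable.
Proof.
move=> _ [A [mA ->]]; apply: fin_bigcap_measurable => // i _.
exact: measurable_funPTI.
Qed.

Lemma measurable_cylinders (J : {set I}) i d3 (W : measurableType d3) (f : U -> W) :
  i \in J -> measurable_fun [set: U] f ->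
  measurable_fun [set: sigmaType J] (fun w => f (Z i w)).
Proof.
move=> iJ mf _ B mB; rewrite setTI; apply: sub_sigma_algebra.
exists (fun j => if j == i then f @^-1` B else setT); split.
  by move=> j; case: ifP => // _; rewrite -[X in measurable X]setTI; exact: mf.
apply/seteqP; split => [w Bw j _|w /(_ i iJ)] /=; last by rewrite eqxx.
by case: eqP => [->|].
Qed.

Hypothesis indep : mutually_independent Z.

(** The product rule over the union of the blocks, for the family that is [A]
    on the first block and [B] on the second one. *)
Lemma cylinders_indep (J1 J2 : {set I}) : (forall i, i \in J1 -> i \notin J2) ->
  forall A B, cylinders J1 A -> cylinders J2 B -> P (A `&` B) = P A * P B.
Proof.
move=> dJ _ _ [A [mA ->]] [B [mB ->]].
pose C i := if i \in J1 then A i else B i.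
have mC i : measurable (C i) by rewrite /C; case: ifP.
have C1 i : i \in J1 -> C i = A i by rewrite /C => ->.
have C2 i : i \in J2 -> C i = B i.
  by move=> iJ; rewrite /C; case: ifPn => // /dJ; rewrite iJ.
rewrite (_ : _ `&` _ = \bigcap_(i in [set` J1 :|: J2]) (Z i @^-1` C i)); last first.
  apply/seteqP; split => [w [wA wB] i /=|w wC].
    rewrite inE => /orP[iJ|iJ]; first by rewrite C1//; exact: wA.
    by rewrite C2//; exact: wB.
  by split => i iJ; [rewrite -C1//|rewrite -C2//]; apply: wC; rewrite /= inE iJ ?orbT.
rewrite !indep//.
have -> : \prod_(i in J1) P (Z i @^-1` A i) = \prod_(i in J1) P (Z i @^-1` C i).
  by apply: eq_bigr => i /C1 ->.
have -> : \prod_(i in J2) P (Z i @^-1` B i) = \prod_(i in J2) P (Z i @^-1` C i).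
  by apply: eq_bigr => i /C2 ->.
rewrite -bigU//; first by apply: eq_bigl => i; rewrite !inE.
by rewrite fintype.disjoint_subset; apply/fintype.subsetP => i /dJ.
Qed.

Lemma measurable_block_diag (J1 J2 : {set I})
    (Q : set (sigmaType J1 * sigmaType J2)) :
  measurable Q -> measurable [set w : T | Q (w, w)].
Proof. by apply: measurable_diag; exact: cylinders_measurable. Qed.

Lemma block_indep_le (J1 J2 : {set I}) (Q : set (sigmaType J1 * sigmaType J2))
    (c : R) :
  (forall i, i \in J1 -> i \notin J2) -> measurable Q ->
  (forall w, P [set w' : T | Q (w, w')] <= c%:E) ->
  P [set w : T | Q (w, w)] <= c%:E.
Proof.
move=> dJ; apply: indep_diag_le.
- exact: cylinders_setI.
- exact: cylinders_setI.
- exact: cylinders_measurable.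
- exact: cylinders_measurable.
- exact: cylinders_indep.
Qed.

(** Split off one variable at a time; it is independent of the block of the
    remaining ones. *)
Lemma indep_expectation_prod (J : {set I}) (f : I -> U -> R) :
  (forall i, measurable_fun [set: U] (f i)) -> (forall i x, 0 <= f i x)%R ->
  \int[P]_w (\prod_(i in J) f i (Z i w))%:E =
  \prod_(i in J) \int[P]_w (f i (Z i w))%:E.
Proof.
move=> mf f0; move En: #|J| => n; elim: n J En => [|n IH] J.
  move/eqP; rewrite cards_eq0 => /eqP ->; rewrite big_set0.
  under eq_integral do rewrite big_set0.
  by rewrite integral_cst// [X in _ * X]probability_setT mule1.
move=> Jn; have [i iJ] : exists i, i \in J by apply/set0Pn; rewrite -cards_eq0 Jn.
rewrite (big_setD1 i)//= -IH; last by move: Jn; rewrite (cardsD1 i) iJ => -[].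
under eq_integral do rewrite (big_setD1 i)//= EFinM.
apply: (@indep_expectation R disp T P (cylinders [set i]%SET) (cylinders (J :\ i))
   _ _ _ _ _ (fun w => (f i (Z i w))%:E)
   (fun w => (\prod_(j in J :\ i) f j (Z j w))%:E)).
- exact: cylinders_setI.
- exact: cylinders_setI.
- exact: cylinders_measurable.
- exact: cylinders_measurable.
- by apply: cylinders_indep => j; rewrite !inE => /eqP ->; rewrite eqxx.
- by apply/measurable_EFinP; apply: measurable_cylinders => //; rewrite inE.
- by move=> w; rewrite lee_fin.
- apply/measurable_EFinP; under eq_fun do rewrite -big_enum/=.
  by apply: measurable_prod => j; rewrite mem_enum => jJ; exact: measurable_cylinders.
- by move=> w; rewrite lee_fin prodr_ge0.
Qed.

End MutualIndependence.

(** * Gaussian vectors and their quadratic forms *)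

Section BorelMeasurability.
Variables (R : realType) (d : nat).

Lemma measurable_coord (i : 'I_d) :
  measurable_fun [set: borel_cV R d] (fun x : 'cV[R]_d => x i 0).
Proof.
apply: (measurability _ (RGenOpens.measurableE R)) => //.
move=> _ [_ [a [b ->] <-]]; rewrite setTI; apply: sub_sigma_algebra.
apply: open_comp; last exact: interval_open.
by move=> x _; exact: coord_continuous.
Qed.

Lemma measurable_frob_inner_cV (u : 'cV[R]_d) :
  measurable_fun [set: borel_cV R d] (fun x : 'cV[R]_d => frob_inner u x).
Proof.
under eq_fun do rewrite frob_inner_cV.
apply: measurable_sum => i; apply: measurable_funM => //.
exact: measurable_coord.
Qed.

Lemma measurable_quad_form (M : 'M[R]_d) :
  measurable_fun [set: borel_cV R d] (fun x : 'cV[R]_d => quad_form M x).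
Proof.
under eq_fun do rewrite quad_form_frob frob_innerE.
apply: measurable_sum => i; apply: measurable_sum => j.
under eq_fun do rewrite mxE big_ord1 mxE.
apply: measurable_funM => //; apply: measurable_funM => //;
  exact: measurable_coord.
Qed.
End BorelMeasurability.

Section GaussianVector.
Context (R : realType) disp (T : measurableType disp) (P : probability T R).
Context (d : nat) (S : 'M[R]_d) (Z : {RV P >-> borel_cV R d}).
Hypothesis Spos : posdef S.
Hypothesis Sle : forall u, quad_form S u <= frob_inner u u.
Hypothesis Zgauss : is_centered_gaussian (distribution P Z) S.

(** Only the law of the projection on [u] enters. *)
Lemma gaussian_mgf (u : 'cV[R]_d) :
  (\int[P]_w (expR (frob_inner u (Z w)))%:E = (expR (quad_form S u / 2))%:E)%E.
Proof.
have [->|u0] := eqVneq u 0.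
  under eq_integral do rewrite /frob_inner mul0mx raddf0 expR0.
  rewrite integral_cst// [X in (_ * X)%E]probability_setT mule1.
  by rewrite /quad_form mulmx0 mxE mul0r expR0.
have v0 : 0 < quad_form S u by have [_] := Spos; apply.
have s0 : Num.sqrt (quad_form S u) != 0 by rewrite gt_eqF// sqrtr_gt0.
have mlin : measurable_fun [set: T] (fun w => frob_inner u (Z w) : measurableTypeR R).
  exact: (measurableT_comp (measurable_frob_inner_cV u) (measurable_funPT Z)).
pose mz := isMeasurableFun.Build _ _ _ _ _ mlin.
pose z : {RV P >-> measurableTypeR R} :=
  HB.pack (fun w => frob_inner u (Z w) : measurableTypeR R) mz.
have mexp : measurable_fun [set: measurableTypeR R]
    (fun x : measurableTypeR R => (expR x)%:E).
  by apply/measurable_EFinP; exact: measurable_expR.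
have exp0 (x : measurableTypeR R) : (0 <= (expR x)%:E)%E by rewrite lee_fin expR_ge0.
transitivity (\int[distribution P z]_x (expR x)%:E)%E.
  by rewrite ge0_integral_distribution.
transitivity (\int[normal_prob 0 (Num.sqrt (quad_form S u))]_x (expR x)%:E)%E.
  apply: eq_measure_integral => A mA _.
  have := Zgauss u mA; rewrite /centered_normal gt_eqF// => h.
  apply: etrans h; rewrite /distribution /pushforward /=; congr (P _).
  have e w : frob_inner u (Z w) = (u^T *m Z w) 0 0.
    by rewrite frob_inner_cV mxE; apply: eq_bigr => i _; rewrite mxE.
  by apply/seteqP; split => w /=; rewrite e.
rewrite (@ge0_integral_density _ _ _ (@lebesgue_measure R) _
  (normal_pdf 0 (Num.sqrt (quad_form S u))))//.
- under eq_integral => x _ do rewrite -EFinM -[X in expR X]mul1r.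
  by rewrite integral_expR_normal_pdf// expr1n mul1r sqr_sqrtr// ltW.
- exact: measurable_normal_pdf.
- by move=> x; exact: normal_pdf_ge0.
Qed.

(** In the coordinates of [sym_diag_wrt_cov] the form is a combination of
    squares of standard Gaussians with coefficients [a], and [frob_inner S M] is
    the sum of these coefficients, that is the mean of the form.  What remains
    of [mgf_signed_squares] is the quadratic term in [a]. *)
Lemma gaussian_quad_mgf (M : 'M[R]_d) (l F : R) :
  M^T = M -> frob_inner M M <= F ^+ 2 -> 0 <= F -> 0 <= l -> 8 * l * F <= 1 ->
  (\int[P]_w (expR (l * (quad_form M (Z w) - frob_inner S M)))%:E <=
   (expR (16 * l ^+ 2 * F ^+ 2))%:E)%E.
Proof.
move=> Msym MF F0 l0 lF.
have [W [a [WSW ME aM]]] := sym_diag_wrt_cov Spos Msym Sle.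
pose z k w := frob_inner (col k W) (Z w).
have mz k : measurable_fun [set: T] (z k).
  exact: (measurableT_comp (measurable_frob_inner_cV _) (measurable_funPT Z)).
have zE k w : z k w = (W^T *m Z w) k 0.
  by rewrite /z frob_inner_cV mxE; apply: eq_bigr => i _; rewrite !mxE.
have zmgf (t : 'I_d -> R) : (\int[P]_w (expR (\sum_k t k * z k w))%:E =
    \prod_k (expR (t k ^+ 2 / 2))%:E)%E.
  pose tv : 'cV[R]_d := \col_k t k.
  rewrite prodEFin -expR_sum -mulr_suml.
  transitivity (\int[P]_w (expR (frob_inner (W *m tv) (Z w)))%:E)%E.
    apply: eq_integral => w _; congr (expR _)%:E.
    rewrite frob_inner_mull frob_inner_cV; apply: eq_bigr => k _.
    by rewrite mxE zE.
  rewrite gaussian_mgf -quad_form_congr WSW quad_formE mul1mx frob_inner_cV.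
  by under eq_bigr do rewrite mxE -expr2.
have qE w : quad_form M (Z w) = \sum_k a 0 k * z k w ^+ 2.
  rewrite ME -{1}(trmxK W) quad_form_congr quad_form_diag.
  by apply: eq_bigr => k _; rewrite zE.
have trE : frob_inner S M = \sum_k a 0 k.
  rewrite ME -mulmxA frob_innerC frob_inner_mull frob_inner_mulr trmxK WSW.
  rewrite frob_innerE; apply: eq_bigr => k _.
  rewrite (bigD1 k)//= big1 ?addr0 => [|j /negPf jk].
    by rewrite !mxE eqxx mulr1n mulr1.
  by rewrite !mxE eq_sym jk mulr0n mul0r.
have aF k : `|a 0 k| <= F.
  rewrite -ler_sqr ?nnegrE ?normr_ge0// real_normK ?num_real//.
  apply: le_trans MF; apply: le_trans aM.
  by rewrite (bigD1 k)//= lerDl sumr_ge0// => j _; rewrite sqr_ge0.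
pose c k := 2 * l * a 0 k.
have c4 k : `|c k| <= 4^-1.
  rewrite normrM ger0_norm ?mulr_ge0//.
  have : 2 * l * `|a 0 k| <= 2 * l * F by rewrite ler_wpM2l// mulr_ge0.
  lra.
have := mgf_signed_squares mz zmgf c4.
pose B := expR (- (l * \sum_k a 0 k)).
have B0 : (0 <= B%:E)%E by rewrite lee_fin expR_ge0.
move=> /(lee_wpmul2l B0).
rewrite -ge0_integralZl//; last first.
- apply/measurable_EFinP; apply: measurableT_comp => //.
  by apply: (measurable_squares mz).
rewrite -EFinM -expRD => H.
rewrite (eq_integral (fun w => B%:E * (expR (\sum_k c k / 2 * z k w ^+ 2))%:E)%E).
  apply: le_trans H _; rewrite lee_fin ler_expR.
  rewrite big_split/= -mulr_sumr.
  rewrite (_ : \sum_k c k / 2 = l * \sum_k a 0 k); last first.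
    by rewrite mulr_sumr; apply: eq_bigr => k _; rewrite /c; field.
  rewrite (_ : \sum_k c k ^+ 2 = (2 * l) ^+ 2 * \sum_k a 0 k ^+ 2); last first.
    by rewrite mulr_sumr; apply: eq_bigr => k _; rewrite /c exprMn.
  rewrite addKr.
  have : (4 * (2 * l) ^+ 2) * (\sum_k a 0 k ^+ 2) <= (4 * (2 * l) ^+ 2) * F ^+ 2.
    apply: ler_wpM2l; first by rewrite mulr_ge0// sqr_ge0.
    exact: le_trans MF.
  by rewrite exprMn; lra.
move=> w _; rewrite -EFinM -expRD qE trE mulrBr addrC; congr (expR (_ + _))%:E.
by rewrite mulr_sumr; apply: eq_bigr => k _; rewrite /c; field.
Qed.

End GaussianVector.

(** * Deviations of empirical covariances *)

Lemma exp_markov (R : realType) disp (T : measurableType disp)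
    (P : probability T R) (h : T -> R) (a : R) : measurable_fun [set: T] h ->
  (P [set w | a <= h w]%R <= (expR (- a))%:E * \int[P]_w (expR (h w))%:E)%E.
Proof.
move=> mh.
set B := [set w | a <= h w].
have mB : measurable B by rewrite -[B]setTI; exact: measurable_fun_le.
have mexp : measurable_fun [set: T] (fun w => (expR (h w))%:E).
  by apply/measurable_EFinP; apply: measurableT_comp.
rewrite expRN lee_pdivlMl ?expR_gt0// -integral_cst//.
apply: (@le_trans _ _ (\int[P]_(w in B) (expR (h w))%:E)%E).
  apply: ge0_le_integral => //.
  - by move=> w _; rewrite lee_fin expR_ge0.
  - exact: measurable_funTS.
  - by move=> w Bw; rewrite lee_fin ler_expR.
by apply: ge0_subset_integral => // w _; rewrite lee_fin expR_ge0.
Qed.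

Section Sample.
Context (R : realType) disp (T : measurableType disp) (P : probability T R).
Context (d : nat) (I : finType) (Z : I -> {RV P >-> borel_cV R d}).
Hypothesis indep : mutually_independent Z.
Context (k : nat) (idx : 'I_k -> I) (S : 'M[R]_d).
Hypothesis idx_inj : injective idx.
Hypothesis k0 : (0 < k)%N.
Hypothesis Spos : posdef S.
Hypothesis Sle : forall u, quad_form S u <= frob_inner u u.
Hypothesis Zgauss : forall i, is_centered_gaussian (distribution P (Z (idx i))) S.

Definition cov_error (w : T) : 'M[R]_d :=
  emp_cov (fun i => Z (idx i) w : 'cV[R]_d) - S.

Lemma frob_inner_cov_error w M : k%:R * frob_inner (cov_error w) M =
  \sum_(i < k) (quad_form M (Z (idx i) w) - frob_inner S M).
Proof.
have k0' : k%:R != 0 :> R by rewrite pnatr_eq0 -lt0n.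
rewrite /cov_error frob_innerBl /emp_cov frob_innerZl frob_inner_suml.
rewrite mulrBr mulrA divff// mul1r sumrB sumr_const card_ord mulr_natl.
by congr (_ - _); apply: eq_bigr => i _; rewrite quad_form_frob.
Qed.

(** Measurability with respect to the block of the sample only, as needed to
    use its independence from the other sample. *)
Lemma measurable_cov_error_entry (J : {set I}) i j : (forall l, idx l \in J) ->
  measurable_fun [set: g_sigma_algebraType (cylinders Z J)]
    (fun w => cov_error w i j).
Proof.
move=> idxJ; rewrite /cov_error /emp_cov.
under eq_fun do rewrite !mxE summxE.
apply: measurable_funB => //; apply: measurable_funM => //.
apply: measurable_sum => l; under eq_fun do rewrite mxE big_ord1 mxE.
apply: measurable_funM.
  exact: (measurable_cylinders (idxJ l) (measurable_coord i)).
exact: (measurable_cylinders (idxJ l) (measurable_coord j)).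
Qed.

Lemma measurable_cov_error i j : measurable_fun [set: T] (fun w => cov_error w i j).
Proof.
rewrite /cov_error /emp_cov; under eq_fun do rewrite !mxE summxE.
apply: measurable_funB => //; apply: measurable_funM => //.
apply: measurable_sum => l; under eq_fun do rewrite mxE big_ord1 mxE.
by apply: measurable_funM;
  exact: (measurableT_comp (measurable_coord _) (measurable_funPT (Z (idx l)))).
Qed.

Lemma measurable_frob_inner_cov_error M :
  measurable_fun [set: T] (fun w => frob_inner (cov_error w) M).
Proof.
under eq_fun do rewrite frob_innerE.
do 2 (apply: measurable_sum => ?); apply: measurable_funM => //.
exact: measurable_cov_error.
Qed.

(** Chernoff's bound with parameter [l = Num.sqrt (t / k%:R) / (8 * F)] per
    observation.  The hypothesis [t <= k%:R] is exactly what makes [l] admissible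
    in [gaussian_quad_mgf], and the exponential moment then contributes
    [16 * k%:R * l ^+ 2 * F ^+ 2 = t / 4]. *)
Lemma cov_error_tail (M : 'M[R]_d) (F t A : R) :
  M^T = M -> frob_inner M M <= F ^+ 2 -> 0 < F -> 0 <= t <= k%:R ->
  (P [set w | A * F * Num.sqrt (t / k%:R) <= frob_inner (cov_error w) M]%R <=
   (expR (- ((A / 8 - 4^-1) * t)))%:E)%E.
Proof.
move=> Msym MF F0 /andP[t0 tk].
have k0' : 0 < k%:R :> R by rewrite ltr0n.
set r := Num.sqrt _; have r0 : 0 <= r := sqrtr_ge0 _.
have r2 : r ^+ 2 = t / k%:R by rewrite sqr_sqrtr// divr_ge0// ltW.
have r1 : r <= 1 by rewrite -sqrtr1 ler_sqrt// ler_pdivrMr// mul1r.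
pose l := r / (8 * F).
have l0 : 0 <= l by rewrite divr_ge0// mulr_ge0// ltW.
have lF : 8 * l * F <= 1.
  by rewrite (_ : 8 * l * F = r)// /l; field; rewrite gt_eqF.
pose f (x : 'cV[R]_d) := expR (l * (quad_form M x - frob_inner S M)).
have mf : measurable_fun [set: borel_cV R d] f.
  apply: measurableT_comp => //; apply: measurable_funM => //.
  by apply: measurable_funB => //; exact: measurable_quad_form.
have mh : measurable_fun [set: T]
    (fun w => l * (k%:R * frob_inner (cov_error w) M)).
  by apply: measurable_funM => //; apply: measurable_funM => //;
    exact: measurable_frob_inner_cov_error.
have lk0 : 0 <= l * k%:R by rewrite mulr_ge0// ltW.
apply: (@le_trans _ _
    (P [set w | A * t / 8 <= l * (k%:R * frob_inner (cov_error w) M)])).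
  apply: le_measure; rewrite ?inE.
  - rewrite -[X in measurable X]setTI; apply: measurable_fun_le => //.
    exact: measurable_frob_inner_cov_error.
  - by rewrite -[X in measurable X]setTI; exact: measurable_fun_le.
  - move=> w /= /(ler_wpM2l lk0) H; rewrite [leRHS]mulrA; apply: le_trans H.
    rewrite (_ : l * _ * _ = A * (r ^+ 2 * k%:R) / 8).
      by rewrite r2 divfK// gt_eqF.
    by rewrite /l; field; rewrite gt_eqF.
apply: le_trans (exp_markov _ _ mh) _.
rewrite (eq_integral (fun w =>
    (\prod_(i in idx @: [set: 'I_k]%SET) f (Z i w))%:E)); last first.
  move=> w _; rewrite frob_inner_cov_error mulr_sumr expR_sum big_imset/=; last first.
    by move=> i j _ _; exact: idx_inj.
  by congr (_%:E); apply: eq_bigl => i; rewrite inE.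
rewrite (@indep_expectation_prod _ _ _ _ _ _ _ Z indep _ (fun=> f)) => //; last first.
  by move=> _ x; exact: expR_ge0.
rewrite big_imset/=; last by move=> i j _ _; exact: idx_inj.
have fle i : (\int[P]_w (f (Z (idx i) w))%:E <= (expR (t / 4 / k%:R))%:E)%E.
  have := gaussian_quad_mgf Spos Sle (@Zgauss i) Msym MF (ltW F0) l0 lF.
  rewrite (_ : 16 * l ^+ 2 * F ^+ 2 = t / 4 / k%:R)//.
  rewrite /l expr_div_n r2; field; rewrite !gt_eqF//.
apply: (@le_trans _ _ ((expR (- (A * t / 8)))%:E *
    \prod_(i < k) (expR (t / 4 / k%:R))%:E)%E).
  apply: lee_wpmul2l; first by rewrite lee_fin expR_ge0.
  rewrite [leRHS](eq_bigl (fun i => i \in [set: 'I_k]%SET)); last first.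
    by move=> i; rewrite inE.
  have [] // : (0 <= \prod_(i in [set: 'I_k]%SET) \int[P]_w (f (Z (idx i) w))%:E /\
      \prod_(i in [set: 'I_k]%SET) \int[P]_w (f (Z (idx i) w))%:E <=
      \prod_(i in [set: 'I_k]%SET) (expR (t / 4 / k%:R))%:E)%E.
  apply: (big_rec2 (fun x y => (0 <= x /\ x <= y)%E)) => [|i x y _ [x0 xy]].
    by rewrite lee_fin lexx ler01.
  have fi0 : (0 <= \int[P]_w (f (Z (idx i) w))%:E)%E.
    by apply: integral_ge0 => w _; rewrite lee_fin expR_ge0.
  by split; [exact: mule_ge0|exact: lee_pmul].
rewrite prodEFin -EFinM -expR_sum -expRD lee_fin ler_expR sumr_const card_ord.
rewrite -[_ *+ k]mulr_natr divfK ?gt_eqF//; lra.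
Qed.
End Sample.

(** * A net of the unit ball *)

Section Net.
Variable R : realType.

(** A sign and a magnitude for every coordinate; the magnitude of a net point is
    at most [16 * d] because its square is. *)
Definition lattice_index d := {ffun 'I_d -> bool * 'I_(16 * d).+1}.

(** The mesh [(4 * Num.sqrt d%:R)^-1] makes the rounding error of a unit vector
    at most [4^-1] in norm. *)
Definition lattice_point d (f : lattice_index d) : 'cV[R]_d :=
  \col_i ((-1) ^+ (f i).1 * (f i).2%:R / (4 * Num.sqrt d%:R)).

(** Integer form of the condition that the point lies in the unit ball. *)
Definition in_net d (f : lattice_index d) : bool :=
  (\sum_i (f i).2 ^ 2 <= 16 * d)%N.

Lemma geometric_half (n : nat) : \sum_(k < n) (2^-1 : R) ^+ k <= 2.
Proof.
suff -> : \sum_(k < n) (2^-1 : R) ^+ k = 2 - 2 * 2^-1 ^+ n.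
  by rewrite gerBl mulr_ge0// exprn_ge0.
elim: n => [|n IH]; first by rewrite big_ord0 expr0; lra.
rewrite big_ord_recr/= IH exprS; lra.
Qed.

(** Each net point is counted with the weight
    [\prod_i 2 ^+ 16 * 2^-1 ^+ (f i).2], which is at least one because
    the magnitudes add up to at most [16 * d].  The sum of these weights over
    all lattice points is a product of [d] truncated geometric series. *)
Lemma card_net d :
  (#|[pred f : lattice_index d | in_net f]|%:R : R) <= 2 ^+ (18 * d).
Proof.
pose G (p : bool * 'I_(16 * d).+1) : R := 2 ^+ 16 * 2^-1 ^+ p.2.
have G0 p : 0 <= G p by rewrite mulr_ge0// exprn_ge0.
rewrite -sum1_card natr_sum.
apply: (@le_trans _ _ (\sum_(f : lattice_index d) \prod_i G (f i))).
  rewrite [leRHS](bigID (fun f => in_net f))/= -[leLHS]addr0.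
  apply: lerD; last by apply: sumr_ge0 => f _; apply: prodr_ge0.
  apply: ler_sum => f; rewrite inE => ff; rewrite big_split/= prodr_const card_ord.
  rewrite -exprM prodrXr exprVn -ler_pdivrMr// ?invr_gt0 ?exprn_gt0//.
  rewrite invrK mul1r ler_eXn2l//; last by rewrite ltr1n.
  apply: leq_trans ff; apply: leq_sum => i _.
  by case: (nat_of_ord _) => // k; rewrite expnS expn1 leq_pmulr.
rewrite -(bigA_distr_bigA (fun _ p => G p)) exprM prodr_const card_ord.
apply: lerXn2r; rewrite ?nnegrE ?exprn_ge0//; first exact: sumr_ge0.
rewrite -(pair_bigA _ (fun b k => G (b, k)))/= big_bool/= /G/= -mulr_sumr.
have := geometric_half (16 * d).+1; set s := \sum_(i < _) _ => s2.
rewrite (_ : 2 ^+ 18 = 2 ^+ 16 * 2 + 2 ^+ 16 * 2 :> R); last by rewrite !exprS; ring.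
by apply: lerD; apply: ler_wpM2l => //; apply: exprn_ge0.
Qed.

Lemma net_norm d (f : lattice_index d) : (0 < d)%N -> in_net f ->
  frob_inner (lattice_point f) (lattice_point f) <= 1.
Proof.
move=> d0 ff; have d0' : 0 < d%:R :> R by rewrite ltr0n.
rewrite frob_inner_cV (eq_bigr (fun i => ((f i).2 ^ 2)%:R / (16 * d%:R))).
  rewrite -mulr_suml -natr_sum ler_pdivrMr ?mulr_gt0// mul1r -natrM.
  by rewrite ler_nat.
move=> i _; rewrite !mxE -expr2 !exprMn exprVn exprMn sqr_sqrtr ?ltW//.
rewrite sqrr_sign mul1r natrX; congr (_ / _); ring.
Qed.

(** Round every coordinate towards zero, so that the norm does not increase. *)
Lemma net_approx d (x : 'cV[R]_d) : (0 < d)%N -> frob_inner x x = 1 ->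
  exists2 f : lattice_index d, in_net f &
    frob_inner (x - lattice_point f) (x - lattice_point f) <= 16^-1.
Proof.
move=> d0 x1; have d0' : 0 < d%:R :> R by rewrite ltr0n.
pose h : R := 4 * Num.sqrt d%:R.
have h0 : 0 < h by rewrite mulr_gt0// sqrtr_gt0.
have h2 : h ^+ 2 = 16 * d%:R.
  by rewrite exprMn sqr_sqrtr ?ltW//; ring.
pose k i := Num.truncn (`|x i 0| * h).
have y0 i : 0 <= `|x i 0| * h by rewrite mulr_ge0// ltW.
have ky i : (k i)%:R <= `|x i 0| * h by rewrite truncn_le.
have yk i : `|x i 0| * h < (k i).+1%:R by rewrite truncnS_gt.
have ksum : (\sum_i k i ^ 2 <= 16 * d)%N.
  rewrite -(ler_nat R) natr_sum natrM -h2.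
  rewrite -[leRHS]mulr1 -[X in _ <= _ * X]x1 frob_inner_cV mulr_sumr.
  apply: ler_sum => i _; rewrite natrX -expr2 -[x i 0 ^+ 2]real_normK ?num_real//.
  rewrite -exprMn.
  by apply: lerXn2r; rewrite ?nnegrE ?mulr_ge0 ?(ltW h0)// mulrC ky.
have kN i : (k i < (16 * d).+1)%N.
  rewrite ltnS; apply: leq_trans ksum; rewrite (bigD1 i)//=.
  apply: leq_trans (leq_addr _ _).
  by case: (k i) => // n; rewrite expnS expn1 leq_pmulr.
pose f : lattice_index d := [ffun i => (x i 0 < 0, Ordinal (kN i))].
exists f.
  rewrite /in_net; under eq_bigr do rewrite ffunE/=; exact: ksum.
rewrite frob_inner_cV.
rewrite (_ : 16^-1 = \sum_(i < d) (h ^- 2)); last first.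
  rewrite sumr_const card_ord h2 -[RHS]mulr_natr; field; by rewrite gt_eqF.
apply: ler_sum => i _; rewrite !mxE ffunE/= -/h -expr2 -exprVn.
have xE : x i 0 = (-1) ^+ (x i 0 < 0)%R * `|x i 0| by rewrite -realEsign ?num_real.
set sg := (-1) ^+ _ in xE *.
rewrite (_ : x i 0 - _ = sg * (`|x i 0| - (k i)%:R / h)); last first.
  by rewrite mulrBr -xE mulrA.
rewrite exprMn sqrr_sign mul1r.
rewrite lerXn2r ?nnegrE ?invr_ge0 ?(ltW h0)//.
  by rewrite subr_ge0 ler_pdivrMr.
rewrite lerBlDr -[X in X + _]mul1r -mulrDl ler_pdivlMr// ltW//.
by have := yk i; rewrite -natr1 addrC.
Qed.

(** Let [x] be a unit eigenvector for the eigenvalue of largest modulus [q] and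
    [g] a net point with [x - g] of norm at most [4^-1].  Then the form at [g]
    is at least [q * (1 - 2 / 4 - 1 / 16)], hence at least [q / 3], in absolute
    value, and there are [d] eigenvalues. *)
Lemma frob_inner_le_net d (E : 'M[R]_d) (tau : R) : (0 < d)%N -> E^T = E ->
  (forall f : lattice_index d, in_net f ->
     `|quad_form E (lattice_point f)| <= tau) ->
  frob_inner E E <= d%:R * (3 * tau) ^+ 2.
Proof.
move=> d0 Esym Etau.
have [Q [e [QQ EE]]] := sym_spectral Esym.
pose i0 := Ordinal d0.
have [j _ jmax] := @arg_maxP _ R 'I_d i0 xpredT (fun i => `|e 0 i|) isT.
pose q := `|e 0 j|; have q0 : 0 <= q := normr_ge0 _.
have eq2 i : e 0 i ^+ 2 <= q ^+ 2.
  by rewrite -real_normK ?num_real// lerXn2r ?nnegrE//; exact: jmax.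
have quadq y : `|quad_form E y| <= q * frob_inner y y.
  rewrite EE quad_form_congr quad_form_diag -(frob_inner_orthogonal y QQ).
  rewrite [in leRHS]frob_inner_cV mulr_sumr.
  apply: le_trans (ler_norm_sum _ _ _) _; apply: ler_sum => i _.
  rewrite normrM (ger0_norm (sqr_ge0 _)) -expr2; apply: ler_wpM2r.
    exact: sqr_ge0.
  exact: jmax.
pose x : 'cV[R]_d := Q^T *m delta_mx j 0.
have Qx : Q *m x = delta_mx j 0 by rewrite mulmxA QQ mul1mx.
have x1 : frob_inner x x = 1.
  rewrite -(frob_inner_orthogonal x QQ) Qx frob_inner_cV (bigD1 j)//= big1.
    by rewrite !mxE !eqxx mulr1 addr0.
  by move=> i /negPf ij; rewrite mxE ij mul0r.
have Ex : E *m x = e 0 j *: x.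
  rewrite EE -mulmxA Qx -mulmxA scalemxAr; congr (_ *m _).
  rewrite mul_diag_mx; apply/matrixP => i l; rewrite !mxE ord1.
  by case: eqP => [->|] //=; rewrite !mulr0.
have [f ff fx] := net_approx d0 x1.
set g := lattice_point f in fx.
have [y gE yx] : exists2 y, g = x - y & frob_inner y y <= 16^-1.
  by exists (x - g) => //; rewrite opprB addrC subrK.
have quadg : quad_form E g = e 0 j - 2 * e 0 j * frob_inner x y + quad_form E y.
  have Eyx : frob_inner (E *m y) x = e 0 j * frob_inner x y.
    by rewrite frob_inner_mull Esym Ex frob_innerZr frob_innerC.
  rewrite gE !quad_formE mulmxBr frob_innerBl !frob_innerBr Eyx Ex !frob_innerZl x1.
  by ring.
have xy : `|frob_inner x y| <= 4^-1.
  rewrite -ler_sqr ?nnegrE// real_normK ?num_real//.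
  apply: le_trans (cauchy_schwarz _ _) _; rewrite x1 mul1r.
  by apply: le_trans yx _; lra.
have qtau : q <= 3 * tau.
  have := Etau f ff; rewrite -/g quadg => H.
  have H1 := quadq y.
  have H2 : `|2 * e 0 j * frob_inner x y| <= 2 * q * 4^-1.
    by rewrite normrM normrM (ger0_norm (_ : 0 <= 2))// ler_wpM2l// mulr_ge0.
  have H3 : q * frob_inner y y <= q * 16^-1 by rewrite ler_wpM2l.
  have H4 : q <= `|e 0 j - 2 * e 0 j * frob_inner x y + quad_form E y| +
      `|2 * e 0 j * frob_inner x y| + `|quad_form E y|.
    rewrite /q {1}(_ : e 0 j = (e 0 j - 2 * e 0 j * frob_inner x y + quad_form E y)
      + 2 * e 0 j * frob_inner x y - quad_form E y); last by ring.
    apply: le_trans (ler_normB _ _) _; rewrite lerD2r; exact: ler_normD.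
  lra.
rewrite EE frob_inner_spectral//.
apply: (@le_trans _ _ (\sum_(i < d) q ^+ 2)); first by apply: ler_sum.
rewrite sumr_const card_ord -[_ *+ d]mulr_natl ler_wpM2l// lerXn2r ?nnegrE//.
exact: le_trans qtau.
Qed.

End Net.

(** * Optimizers of the Gromov-Wasserstein objective *)

Section GWBasicInequality.
Variable R : realType.

(** Expand the optimality of [p] against [s].  The deterministic part of the
    objective is minus half the squared distance of the two permuted
    covariances, by polarization, because both have the norm of [S]. *)
Lemma gw_basic_inequality d (S E F : 'M[R]_d) (s p : 'S_d) :
  gw_optimizer (S + E) (conj_perm S s + F) p ->
  frob_inner (conj_perm S p - conj_perm S s) (conj_perm S p - conj_perm S s) / 2
  <= frob_inner E (conj_perm (conj_perm S s) p^-1%g - S)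
     + frob_inner F (conj_perm S p - conj_perm S s)
     + frob_inner F (conj_perm E p - conj_perm E s).
Proof.
move=> /(_ s); rewrite !frob_innerBl !frob_innerBr.
rewrite !conj_permD !frob_innerDl !frob_innerDr.
have SS : frob_inner (conj_perm S p) (conj_perm S p) = frob_inner S S.
  exact: frob_inner_conj.
have SS' : frob_inner (conj_perm S s) (conj_perm S s) = frob_inner S S.
  exact: frob_inner_conj.
rewrite SS SS'.
rewrite -(frob_inner_conjl E (conj_perm S s) p).
have -> : frob_inner E S = frob_inner (conj_perm E s) (conj_perm S s).
  by rewrite frob_inner_conj.
rewrite (frob_innerC (conj_perm S s) (conj_perm S p)) !(frob_innerC F).
lra.
Qed.

Lemma frob_inner_unaligned d (S : 'M[R]_d) (s p : 'S_d) :
  let M := conj_perm (conj_perm S s) p^-1%g - S in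
  let D := conj_perm S p - conj_perm S s in
  frob_inner M M = frob_inner D D.
Proof.
move=> M D; rewrite -(frob_inner_conj M M p) conj_permB conj_permM mulgV conj_perm1.
by rewrite -[_ - _]opprB frob_innerNl frob_innerNr opprK.
Qed.

End GWBasicInequality.

(** * Uniform deviation events *)

Lemma union_bound (R : realType) disp (T : measurableType disp)
    (P : probability T R) (J : finType) (Q : pred J) (B : J -> set T) (c : R) :
  (forall j, Q j -> measurable (B j)) -> (forall j, Q j -> (P (B j) <= c%:E)%E) ->
  exists U : set T, [/\ measurable U, (P U <= (#|[pred j | Q j]|%:R * c)%:E)%E &
    forall w, ~ U w -> forall j, Q j -> ~ B j w].
Proof.
move=> mB PB.
suff H (s : seq J) : {subset s <= [pred j | Q j]} ->
    exists U : set T, [/\ measurable U, (P U <= ((size s)%:R * c)%:E)%E &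
    forall w, ~ U w -> forall j, j \in s -> ~ B j w].
  have [|U [mU PU UB]] := H (enum [pred j | Q j]).
    by move=> j; rewrite mem_enum.
  exists U; split => //; first by rewrite cardE.
  by move=> w Uw j Qj; apply: UB => //; rewrite mem_enum.
elim: s => [_|j s IH js].
  by exists set0; split => //; rewrite measure0 mul0r.
have [|U [mU PU UB]] := IH; first by move=> i si; apply: js; rewrite in_cons si orbT.
have Qj : Q j by have := js j (mem_head _ _).
have mj := mB j Qj.
exists (B j `|` U); split; first exact: measurableU.
  apply: le_trans (measureU2 _ _ _) _ => //=.
  by rewrite -natr1 mulrDl mul1r addrC EFinD; apply: leeD => //; exact: PB.
move=> w /not_orP[Bw Uw] i; rewrite in_cons => /orP[/eqP ->//|]; exact: UB.
Qed.

Section SampleEvents.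
Context (R : realType) disp (T : measurableType disp) (P : probability T R).
Context (d : nat) (I : finType) (Z : I -> {RV P >-> borel_cV R d}).
Hypothesis indep : mutually_independent Z.
Context (k : nat) (idx : 'I_k -> I) (S : 'M[R]_d).
Hypothesis idx_inj : injective idx.
Hypothesis k0 : (0 < k)%N.
Hypothesis Spos : posdef S.
Hypothesis Sle : forall u, quad_form S u <= frob_inner u u.
Hypothesis Zgauss : forall i, is_centered_gaussian (distribution P (Z (idx i))) S.

Local Notation E := (cov_error Z idx S).
Local Notation rate t := (Num.sqrt (t / k%:R)).

Lemma cov_error_sym w : (E w)^T = E w.
Proof.
have [Ssym _] := Spos.
rewrite /cov_error linearB/= Ssym /emp_cov linearZ/= raddf_sum/=.
by congr (_ *: _ - _); apply: eq_bigr => i _; rewrite trmx_mul trmxK.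
Qed.

Lemma cov_error_tail18 (M : 'M[R]_d) (F t : R) :
  M^T = M -> frob_inner M M <= F ^+ 2 -> 0 < F -> 0 <= t <= k%:R ->
  (P [set w | 18 * F * rate t <= frob_inner (E w) M]%R <= (expR (- (2 * t)))%:E)%E.
Proof.
move=> Msym MF F0 tk.
have := cov_error_tail indep idx_inj k0 Spos Sle Zgauss 18 Msym MF F0 tk.
by rewrite (_ : 18 / 8 - 4^-1 = 2 :> R)//; lra.
Qed.

Lemma cov_error_perm_event (M : 'S_d -> 'M[R]_d) (t : R) :
  (forall p, (M p)^T = M p) -> 0 <= t <= k%:R ->
  exists U : set T, [/\ measurable U, (P U <= (d`!%:R * expR (- (2 * t)))%:E)%E &
    forall w, ~ U w -> forall p,
      frob_inner (E w) (M p) <= 18 * frob_norm (M p) * rate t].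
Proof.
move=> Msym tk.
pose B p := [set w | 18 * frob_norm (M p) * rate t <= frob_inner (E w) (M p)].
have [||U [mU PU UB]] := @union_bound _ _ _ P 'S_d (fun p => M p != 0) B
    (expR (- (2 * t))).
- move=> p _; rewrite -[B p]setTI; apply: measurable_fun_le => //.
  exact: measurable_frob_inner_cov_error.
- move=> p Mp; apply: cov_error_tail18 => //; first by rewrite frob_norm_sqr.
  rewrite lt_def frob_norm_ge0 andbT; apply: contra Mp.
  by rewrite -frob_inner_eq0 -frob_norm_sqr sqrf_eq0.
exists U; split => //.
  apply: le_trans PU _; rewrite lee_fin ler_wpM2r ?expR_ge0// ler_nat.
  by rewrite -card_Sn max_card.
move=> w /UB Bw p; have [->|Mp] := eqVneq (M p) 0.
  by rewrite /frob_norm /frob_inner trmx0 !mulmx0 raddf0 sqrtr0 mulr0 mul0r.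
by rewrite leNgt; apply/negP => /ltW; exact: Bw.
Qed.

(** Both signs of [g *m g^T], which has norm at most one, are tested for every
    net point [g]: this is the origin of [2 ^+ (18 * d) * 2].  The factor 338 is
    chosen for the exponent 42 to beat this cardinal. *)
Lemma cov_error_frob_event (t : R) : (0 < d)%N -> 0 <= t <= k%:R ->
  exists U : set T,
    [/\ measurable U, (P U <= (2 ^+ (18 * d) * 2 * expR (- (42 * t)))%:E)%E &
    forall w, ~ U w ->
      frob_inner (E w) (E w) <= d%:R * (3 * (338 * rate t)) ^+ 2].
Proof.
move=> d0 tk.
pose M (q : lattice_index d * bool) : 'M[R]_d :=
  (-1) ^+ q.2 *: (lattice_point R q.1 *m (lattice_point R q.1)^T).
pose B q := [set w | 338 * 1 * rate t <= frob_inner (E w) (M q)].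
have [||U [mU PU UB]] := @union_bound _ _ _ P (lattice_index d * bool)%type
    (fun q => in_net q.1) B (expR (- (42 * t))).
- move=> q _; rewrite -[B q]setTI; apply: measurable_fun_le => //.
  exact: measurable_frob_inner_cov_error.
- move=> q qnet.
  have := @cov_error_tail _ _ _ _ _ _ _ indep _ _ _ idx_inj k0 Spos Sle Zgauss
    (M q) 1 t 338.
  rewrite (_ : 338 / 8 - 4^-1 = 42 :> R); last by lra.
  apply => //.
    by rewrite /M linearZ/= trmx_mul trmxK.
  rewrite /M frob_innerZl frob_innerZr mulrA -expr2 sqrr_sign mul1r.
  rewrite -quad_form_frob quad_formE -mulmxA.
  rewrite [X in _ *m X]mx11_scalar mul_mx_scalar frob_innerZl.
  rewrite (_ : (_ *m _) 0 0 = frob_inner (lattice_point R q.1) (lattice_point R q.1)).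
    by rewrite -expr2 lerXn2r ?nnegrE ?frob_inner_ge0// net_norm.
  by rewrite frob_inner_cV mxE; apply: eq_bigr => i _; rewrite mxE.
exists U; split => //.
  apply: le_trans PU _; rewrite lee_fin ler_wpM2r ?expR_ge0//.
  rewrite (_ : #|_| = (#|[pred f : lattice_index d | in_net f]| * 2)%N).
    by rewrite natrM ler_wpM2r// card_net.
  rewrite -[X in _ = (_ * X)%N]card_bool -cardX; apply: eq_card => -[f b].
  by rewrite !inE andbT.
move=> w /UB Bw; apply: frob_inner_le_net => //; first exact: cov_error_sym.
move=> f fnet; rewrite ler_norml quad_form_frob frob_innerC.
have /= := Bw (f, false) fnet; have /= := Bw (f, true) fnet.
rewrite /B/M/= expr0 expr1 scale1r scaleN1r frob_innerNr mulr1.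
by move=> /negP; rewrite -ltNge => H1 /negP; rewrite -ltNge => H2; lra.
Qed.

End SampleEvents.

Section CrossEvent.
Context (R : realType) disp (T : measurableType disp) (P : probability T R).
Context (d : nat) (I : finType) (Z : I -> {RV P >-> borel_cV R d}).
Hypothesis indep : mutually_independent Z.
Context (k1 k2 : nat) (idx1 : 'I_k1 -> I) (idx2 : 'I_k2 -> I).
Hypothesis idx12 : forall i j, idx1 i != idx2 j.
Context (S1 S2 : 'M[R]_d).
Hypothesis S1pos : posdef S1.
Hypothesis idx2_inj : injective idx2.
Hypothesis k2_gt0 : (0 < k2)%N.
Hypothesis S2pos : posdef S2.
Hypothesis S2le : forall u, quad_form S2 u <= frob_inner u u.
Hypothesis Zgauss2 :
  forall i, is_centered_gaussian (distribution P (Z (idx2 i))) S2.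

Local Notation E1 := (cov_error Z idx1 S1).
Local Notation E2 := (cov_error Z idx2 S2).
Local Notation rate t := (Num.sqrt (t / k2%:R)).

(** Given the first sample, the second factor of the inner product is a fixed
    matrix of norm at most [2 * Num.sqrt q], so the tail bound for fixed matrices
    applies. *)
Lemma cov_error_cross_event (s : 'S_d) (t q : R) : 0 < q -> 0 <= t <= k2%:R ->
  exists U : set T, [/\ measurable U, (P U <= (d`!%:R * expR (- (2 * t)))%:E)%E &
    forall w, ~ U w -> frob_inner (E1 w) (E1 w) <= q -> forall p : 'S_d,
      frob_inner (E2 w) (conj_perm (E1 w) p - conj_perm (E1 w) s) <=
      36 * Num.sqrt q * rate t].
Proof.
move=> q0 tk.
pose J1 := [set idx1 i | i : 'I_k1]%SET; pose J2 := [set idx2 i | i : 'I_k2]%SET.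
have J1P i : idx1 i \in J1 by apply: imset_f.
have J2P i : idx2 i \in J2 by apply: imset_f.
have J12 i : i \in J1 -> i \notin J2.
  move=> /imsetP[a _ ->]; apply/imsetP => -[b _ ab].
  by have := idx12 a b; rewrite ab eqxx.
pose V1 := g_sigma_algebraType (cylinders Z J1).
pose V2 := g_sigma_algebraType (cylinders Z J2).
have m1 i j : measurable_fun [set: V1 * V2] (fun v => E1 v.1 i j).
  exact: (measurableT_comp (measurable_cov_error_entry S1 i j J1P)).
have m2 i j : measurable_fun [set: V1 * V2] (fun v => E2 v.2 i j).
  exact: (measurableT_comp (measurable_cov_error_entry S2 i j J2P)).
pose Q p : set (V1 * V2) := [set v | frob_inner (E1 v.1) (E1 v.1) <= q] `&`
  [set v | 36 * Num.sqrt q * rate t <=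
     frob_inner (E2 v.2) (conj_perm (E1 v.1) p - conj_perm (E1 v.1) s)].
have mQ p : measurable (Q p).
  apply: measurableI; rewrite -[X in measurable X]setTI;
    apply: measurable_fun_le => //.
    under eq_fun do rewrite frob_innerE.
    by do 2 (apply: measurable_sum => ?); apply: measurable_funM.
  under eq_fun do rewrite frob_innerE.
  do 2 (apply: measurable_sum => ?); apply: measurable_funM => //.
  by under eq_fun do rewrite conj_perm_sub_entry; apply: measurable_funB.
pose B p := [set w : T | Q p (w, w)].
have [||U [mU PU UB]] := @union_bound _ _ _ P 'S_d xpredT B (expR (- (2 * t))).
- by move=> p _; exact: (measurable_block_diag (mQ p)).
- move=> p _; apply: (block_indep_le indep J12 (mQ p)) => w.
  have [Ew|Ew] := leP (frob_inner (E1 w) (E1 w)) q; last first.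
    rewrite (_ : [set _ | _] = set0) ?measure0 ?lee_fin ?expR_ge0//.
    by apply/seteqP; split => // w' [/=]; rewrite leNgt Ew.
  rewrite (_ : [set _ | _] = [set w' | 18 * (2 * Num.sqrt q) * rate t <=
      frob_inner (E2 w') (conj_perm (E1 w) p - conj_perm (E1 w) s)]).
    apply: cov_error_tail18 => //.
    + by rewrite linearB/= !tr_conj_perm cov_error_sym.
    + apply: le_trans (frob_inner_sub_le _ _) _.
      rewrite !frob_inner_conj exprMn sqr_sqrtr ?(ltW q0)//; lra.
    + by rewrite mulr_gt0// sqrtr_gt0.
  have e : 18 * (2 * Num.sqrt q) = 36 * Num.sqrt q by ring.
  by apply/seteqP; split => [w' [_ /=]|w' /= H]; [rewrite e|split => //=; rewrite -e].
exists U; split => //.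
  apply: le_trans PU _; rewrite lee_fin ler_wpM2r ?expR_ge0// ler_nat.
  by rewrite -card_Sn max_card.
move=> w /UB Bw Ew p; rewrite leNgt; apply/negP => /ltW H.
by apply: (Bw p isT); split.
Qed.

End CrossEvent.

(** * Numerical bounds and the final rate *)

Section Numerics.
Variable R : realType.

Lemma ln2_ge_half : 2^-1 <= ln 2 :> R.
Proof.
rewrite -ler_expR lnK ?posrE//.
rewrite (_ : expR 2^-1 = (expR (- 2^-1))^-1); last by rewrite expRN invrK.
rewrite -[leRHS]invrK lef_pV2 ?posrE ?expR_gt0 ?invr_gt0//.
by have := @expR_ge1Dx R (- 2^-1); lra.
Qed.

Lemma two_ln_ge1 d : (2 <= d)%N -> 1 <= 2 * ln d%:R :> R.
Proof.
move=> d2; have : ln 2 <= ln d%:R :> R.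
  by rewrite ler_ln ?posrE ?ltr0n ?ler_nat// (leq_trans _ d2).
by have := ln2_ge_half; lra.
Qed.

Lemma fact_le_expn n : (n`! <= n ^ n)%N.
Proof.
rewrite fact_prod -[X in (_ <= _ ^ X)%N]card_ord -prod_nat_const big_add1/=.
by rewrite big_mkord; apply: leq_prod => i _; exact: ltn_ord.
Qed.

(** The factorial is at most [expR (d%:R * ln d%:R)].  One half of the exponent
    cancels it and the other half still gains [d%:R ^- d <= 4^-1]. *)
Lemma perm_union_numerics d (L : R) : (2 <= d)%N -> 0 <= L ->
  d`!%:R * expR (- (2 * (d%:R * ln d%:R + L))) <= expR (- L) / 4.
Proof.
move=> d2 L0; have d0 : 0 < d%:R :> R by rewrite ltr0n (leq_trans _ d2).
have dd : expR (d%:R * ln d%:R) = d%:R ^+ d :> R.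
  by rewrite expRM_natl lnK.
have f1 : d`!%:R <= d%:R ^+ d :> R by rewrite -natrX ler_nat fact_le_expn.
apply: (@le_trans _ _ (d%:R ^+ d * expR (- (2 * (d%:R * ln d%:R + L))))).
  by rewrite ler_wpM2r ?expR_ge0.
rewrite -dd -expRD.
rewrite (_ : _ + _ = - (d%:R * ln d%:R) + (- L - L)); last by ring.
rewrite expRD expRN dd mulrC ler_pM ?expR_ge0 ?invr_ge0 ?exprn_ge0 ?ler0n//.
  by rewrite ler_expR; lra.
rewrite lef_pV2 ?posrE ?exprn_gt0//.
rewrite -natrX ler_nat (@leq_trans (2 ^ d)%N)//; last first.
  by rewrite leq_exp2r ?(leq_trans _ d2).
by rewrite -[4%N]/(2 ^ 2)%N leq_exp2l.
Qed.

Lemma net_union_numerics d (L : R) : (2 <= d)%N -> 0 <= L ->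
  2 ^+ (18 * d) * 2 * expR (- (42 * ((d%:R + L) / 2))) <= expR (- L) / 4.
Proof.
move=> d2 L0.
rewrite (_ : - _ = - (21%:R * d%:R) + (- L - 20 * L)); last by field.
have e2 : (2 : R) <= expR 1 by have := @expR_ge1Dx R 1; lra.
have e21 : 2 ^+ (21 * d) <= expR (21%:R * d%:R) :> R.
  rewrite -natrM -[(21 * d)%:R]mulr1 expRM_natl.
  by rewrite lerXn2r ?nnegrE ?expR_ge0.
rewrite expRD mulrA [leRHS]mulrC; apply: ler_pM.
- by rewrite !mulr_ge0 ?exprn_ge0 ?expR_ge0.
- exact: expR_ge0.
- rewrite expRN ler_pdivrMr ?expR_gt0//.
  apply: le_trans (_ : 4^-1 * 2 ^+ (21 * d) <= _); last by rewrite ler_wpM2l.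
  rewrite (_ : (21 * d = 18 * d + 3 * d)%N); last by rewrite -mulnDl.
  rewrite exprD mulrCA ler_wpM2l ?exprn_ge0//.
  have : 2 ^+ 3 <= 2 ^+ (3 * d) :> R.
    by rewrite ler_eXn2l ?ltr1n// leq_pmulr// (leq_trans _ d2).
  rewrite (_ : 2 ^+ 3 = 8 :> R); last by ring.
  by lra.
- by rewrite ler_expR; lra.
Qed.

(** With [r = Num.sqrt (t / (minn m n)%:R)] the linear terms are at most
    [36 * a * r], which is absorbed through [0 <= (a - 72 * r) ^+ 2]; the cross
    term is at most [36 * (3 * c)] times the square root in the conclusion, and
    clearing the remaining [a ^+ 2 / 4] multiplies it by four. *)
Lemma gw_rate_numerics (d m n : nat) (a t L c : R) :
  (0 < d)%N -> (0 < m)%N -> (0 < n)%N -> 0 <= t -> 0 <= L -> 0 <= a -> 0 <= c ->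
  a ^+ 2 / 2 <= 18 * a * Num.sqrt (t / m%:R) + 18 * a * Num.sqrt (t / n%:R)
    + 36 * Num.sqrt (d%:R * (3 * (c * Num.sqrt ((d%:R + L) / 2 / m%:R))) ^+ 2)
      * Num.sqrt (t / n%:R) ->
  a ^+ 2 <= (72 ^+ 2 + 432 * c) * (t / (minn m n)%:R +
    Num.sqrt (d%:R * t * (d%:R + L) / (m%:R * n%:R))).
Proof.
move=> d0 m0 n0 t0 L0 a0 c0.
have m0' : 0 < m%:R :> R by rewrite ltr0n.
have n0' : 0 < n%:R :> R by rewrite ltr0n.
have d0' : 0 < d%:R :> R by rewrite ltr0n.
have mn0 : 0 < (minn m n)%:R :> R by rewrite ltr0n leq_min m0.
set Qs := Num.sqrt (d%:R * t * _ / _).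
pose r := Num.sqrt (t / (minn m n)%:R).
have rE : r ^+ 2 = t / (minn m n)%:R by rewrite sqr_sqrtr// divr_ge0// ltW.
have rate_le k : (0 < k)%N -> (minn m n <= k)%N -> Num.sqrt (t / k%:R) <= r.
  move=> k0 mk; apply: ler_wsqrtr; apply: ler_wpM2l => //.
  by rewrite lef_pV2 ?posrE ?ltr0n// ?ler_nat// leq_min m0.
have rm := rate_le m m0 (geq_minl _ _); have rn := rate_le n n0 (geq_minr _ _).
have dL0 : 0 <= d%:R + L by rewrite addr_ge0// ltW.
have c3 : 0 <= 3 * c by rewrite mulr_ge0.
have [k kE] : exists k, 3 * c = k by exists (3 * c).
rewrite mulrA kE; rewrite kE in c3.
have Q0 : 0 <= d%:R * t * (d%:R + L) / (m%:R * n%:R).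
  by rewrite divr_ge0 ?mulr_ge0// ltW.
have cross : Num.sqrt (d%:R * (k * Num.sqrt ((d%:R + L) / 2 / m%:R)) ^+ 2)
    * Num.sqrt (t / n%:R) <= k * Qs.
  rewrite -sqrtrM; last by rewrite mulr_ge0 ?sqr_ge0// ltW.
  rewrite -[k in leRHS]ger0_norm// -sqrtr_sqr -sqrtrM ?sqr_ge0//.
  apply: ler_wsqrtr; rewrite exprMn sqr_sqrtr; last first.
    by rewrite divr_ge0 ?divr_ge0// ltW.
  rewrite [leLHS](_ : _ = k ^+ 2 * (d%:R * t * (d%:R + L) / (m%:R * n%:R)) / 2).
    by rewrite ler_pdivrMr// ler_peMr ?mulr_ge0 ?sqr_ge0// ler1n.
  by field; rewrite !gt_eqF.
move=> H; rewrite -rE.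
have arm : a * Num.sqrt (t / m%:R) <= a * r by rewrite ler_wpM2l.
have arn : a * Num.sqrt (t / n%:R) <= a * r by rewrite ler_wpM2l.
have sq : 0 <= (a - 72 * r) ^+ 2 := sqr_ge0 _.
have r20 : 0 <= r ^+ 2 := sqr_ge0 _.
have Qs0 : 0 <= Qs := sqrtr_ge0 _.
have H1 : a ^+ 2 <= 72 ^+ 2 * r ^+ 2 + 432 * c * Qs.
  have -> : 432 * c = 144 * k by rewrite -kE; ring.
  by lra.
apply: le_trans H1 _; rewrite (mulrDl (72 ^+ 2)).
apply: lerD; rewrite ler_wpM2l ?mulr_ge0 ?sqr_ge0//; first by rewrite lerDl.
by rewrite lerDr.
Qed.

End Numerics.

Set Strict Implicit.
Unset Implicit Arguments.

Theorem theorem3 (R : realType) :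
  exists C : R, 0 < C /\
  forall (d m n : nat) (delta : R),
    (0 < d)%N -> (0 < m)%N -> (0 < n)%N -> 0 < delta < 1 ->
    d%:R * ln d%:R + ln (1 / delta) <= (minn m n)%:R ->
  forall (pistar : 'S_d) (Sigma : 'M[R]_d),
    posdef Sigma -> op_norm Sigma <= 1 ->
  forall (disp : measure_display) (T : measurableType disp)
    (P : probability T R)
    (X : 'I_m -> {RV P >-> borel_cV R d})
    (Y : 'I_n -> {RV P >-> borel_cV R d}),
    cov_alignment_model Sigma pistar X Y ->
  forall pihat : T -> 'S_d,
    (forall w, gw_optimizer (emp_cov (fun i => X i w))
                            (emp_cov (fun j => Y j w)) (pihat w)) ->
  with_prob_ge P (1 - delta)
    [set w | frob_norm (conj_perm Sigma (pihat w) - conj_perm Sigma pistar) ^+ 2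
      <= C * ((d%:R * ln d%:R + ln (1 / delta)) / (minn m n)%:R
              + Num.sqrt (d%:R * (d%:R * ln d%:R + ln (1 / delta))
                          * (d%:R + ln (1 / delta))
                          / (m%:R * n%:R)))].
Proof.
have c0 : 0 <= 338 :> R by rewrite ler0n.
exists (72 ^+ 2 + 432 * 338); split.
  by rewrite addr_gt0 ?exprn_gt0 ?mulr_gt0 ?ltr0n.
move=> d m n delta d0 m0 n0 /andP[delta0 delta1].
set L := ln (1 / delta); set t := d%:R * ln d%:R + L => t_le.
move=> s S Spos S1 disp T P X Y [GX GY ind] pihat opt.
have LE : expR (- L) = delta.
  by rewrite expRN lnK ?posrE ?divr_gt0// div1r invrK.
have L0 : 0 <= L by rewrite ln_ge0// ler_pdivlMr// mul1r ltW.
have lnd0 : 0 <= d%:R * ln d%:R :> R by rewrite mulr_ge0// ln_ge0// ler1n.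
have t0 : 0 <= t by rewrite addr_ge0.
(* For [d = 1] there is only one permutation.  From [2 <= d] on, [ln d] is
   bounded away from zero, so that [d] is at most a multiple of [d * ln d]. *)
have [d1|d2] := leqP d 1.
  exists setT; split => //; last by rewrite probability_setT lee_fin; lra.
  move=> w _ /=; rewrite (_ : conj_perm S (pihat w) = conj_perm S s).
    rewrite frob_norm_sqr subrr /frob_inner mul0mx raddf0.
    rewrite mulr_ge0// addr_ge0 ?sqrtr_ge0// divr_ge0//.
  have perm_eq i : pihat w i = s i.
    apply: val_inj; have le1 (k : 'I_d) : (k : nat) = 0%N.
      by apply/eqP; rewrite -leqn0 -ltnS (leq_trans (ltn_ord k)).
    by rewrite /= !le1.
  by apply/matrixP => i j; rewrite !mxE !perm_eq.
have Sle u := quad_form_le_op_norm u S1.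
have S'pos := posdef_conj s Spos; have S'le := quad_form_conj_le s Sle.
have tm : 0 <= t <= m%:R.
  by rewrite t0 (le_trans t_le)// ler_nat geq_minl.
have tn : 0 <= t <= n%:R.
  by rewrite t0 (le_trans t_le)// ler_nat geq_minr.
(* The exponent of the net argument; halved so as to stay below the sample
   size. *)
pose t' : R := (d%:R + L) / 2.
have t't : 0 < t' <= t.
  have d0' : 0 < d%:R :> R by rewrite ltr0n.
  have := ler_wpM2l (ltW d0') (@two_ln_ge1 R d d2).
  by rewrite /t' /t; lra.
have t'm : 0 <= t' <= m%:R by lra.
pose M p := conj_perm (conj_perm S s) p^-1%g - S.
pose D p := conj_perm S p - conj_perm S s.
have [Ssym _] := Spos.
have Msym p : (M p)^T = M p by rewrite linearB/= !tr_conj_perm Ssym.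
have Dsym p : (D p)^T = D p by rewrite linearB/= !tr_conj_perm Ssym.
have inl_inj : injective (@inl 'I_m 'I_n) by move=> i j [].
have inr_inj : injective (@inr 'I_m 'I_n) by move=> i j [].
have lr i j : @inl 'I_m 'I_n i != inr j by [].
set Z := (fun k : 'I_m + 'I_n => _) in ind.
have [U1 [mU1 PU1 H1]] :=
  cov_error_perm_event ind inl_inj m0 Spos Sle GX Msym tm.
have [U2 [mU2 PU2 H2]] :=
  cov_error_perm_event ind inr_inj n0 S'pos S'le GY Dsym tn.
have [U3 [mU3 PU3 H3]] :=
  cov_error_frob_event ind inl_inj m0 Spos Sle GX d0 t'm.
set q := d%:R * _ ^+ 2 in H3.
have q0 : 0 < q.
  rewrite mulr_gt0 ?ltr0n// exprn_gt0// !mulr_gt0// sqrtr_gt0 divr_gt0 ?ltr0n//.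
  by case/andP: t't.
have [U4 [mU4 PU4 H4]] :=
  cov_error_cross_event ind lr Spos inr_inj n0 S'pos S'le GY s q0 tn.
exists (~` (U1 `|` U2 `|` (U3 `|` U4))); split.
- by apply: measurableC; apply: measurableU; apply: measurableU.
- move=> w /= /not_orP[/not_orP[/H1 {}H1 /H2 {}H2] /not_orP[/H3 {}H3 /H4 {}H4]].
  have := opt w.
  have -> : emp_cov (fun i => X i w) = S + cov_error Z inl S w.
    by rewrite /cov_error addrC subrK.
  have -> : emp_cov (fun j => Y j w) =
      conj_perm S s + cov_error Z inr (conj_perm S s) w.
    by rewrite /cov_error addrC subrK.
  move=> /gw_basic_inequality; rewrite -/(D _) -/(M _) -frob_norm_sqr => basic.
  apply: gw_rate_numerics => //; first exact: frob_norm_ge0.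
  apply: le_trans basic _; apply: lerD; last exact: H4.
  apply: lerD; last exact: H2.
  rewrite (_ : frob_norm (D (pihat w)) = frob_norm (M (pihat w))); first exact: H1.
  by rewrite /frob_norm -frob_inner_unaligned.
- have mU : measurable (U1 `|` U2 `|` (U3 `|` U4)).
    by apply: measurableU; apply: measurableU.
  rewrite probability_setC// -[X in (X <= _)%E]/(1%:E - delta%:E)%E.
  apply: leeB => //.
  have quarter (a b : R) : a <= expR (- L) / 4 -> b <= expR (- L) / 4 ->
     a + b <= delta / 2 by rewrite LE; lra.
  apply: le_trans (measureU2 _ _ _) _; [exact: measurableU|exact: measurableU|].
  apply: (@le_trans _ _ ((delta / 2)%:E + (delta / 2)%:E)%E).
    apply: leeD; apply: le_trans (measureU2 _ _ _) _ => //;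
      apply: le_trans (leeD _ _) _; try eassumption; rewrite -EFinD lee_fin;
      apply: quarter; do ?[exact: perm_union_numerics | exact: net_union_numerics].
  by rewrite -EFinD lee_fin; lra.
Qed.
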